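(* Let $\{(X_n,Y_n), n\ge 1\}$ be a sequence of bivariate random vectors (not necessarily independent) with common distribution function $F$ having marginal distribution functions $F_1,F_2$, and let $\{N(t), t\ge 0\}$ be a counting process that is independent of $\{(X_n,Y_n), n\ge 1\}$. Suppose that: (i) $N(t)/t \stackrel{d}{\to} \mathcal{Z}$ as $t\to\infty$, where $\mathcal{Z}$ is an almost surely positive random variable; (ii) $a_i(t)>0$, $b_i(t)$, $i=1,2$, are real functions such that $$\lim_{t\to\infty}\ \sup_{(x,y)\in\mathbb{R}^2}\bigl|F^t(a_1(t)x+b_1(t),\,a_2(t)y+b_2(t))-H(x,y)\bigr|=0$$ for a max-stable bivariate distribution function $H$ whose marginals $H_1,H_2$ are standard extreme value distributions (each $H_i$ is one of $\Phi_{\alpha_i}$, $\Psi_{\alpha_i}$, $\alpha_i>0$, or $\Lambda$); (iii) for some fixed $m\in\mathbb{N}$, with these same functions $a_i,b_i$, as $n\to\infty$, $$\Biggl(\Bigl(\tfrac{X_{n-j+1:n}-b_1(n)}{a_1(n)},\tfrac{Y_{n-j+1:n}-b_2(n)}{a_2(n)}\Bigr)\Biggr)_{j=1,\ldots,m}\ \stackrel{d}{\to}\ \bigl((\mathcal{X}_j,\mathcal{Y}_j)\bigr)_{j=1,\ldots,m}$$ for some random vectors $(\mathcal{X}_j,\mathcal{Y}_j)$, $1\le j\le m$. Then, as $t\to\infty$, $$\Biggl(\Bigl(\tfrac{X_{N(t)-j+1:N(t)}-b_1(t)}{a_1(t)},\tfrac{Y_{N(t)-j+1:N(t)}-b_2(t)}{a_2(t)}\Bigr)\Biggr)_{j=1,\ldots,m}\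 \stackrel{d}{\to}\ \Bigl(\bigl(\mathcal{Z}^{\gamma_1}\mathcal{X}_j+\delta_1,\ \mathcal{Z}^{\gamma_2}\mathcal{Y}_j+\delta_2\bigr)\Bigr)_{j=1,\ldots,m},$$ where on the right-hand side $\mathcal{Z}$ is independent of $((\mathcal{X}_j,\mathcal{Y}_j))_{1\le j\le m}$, and for $i=1,2$: $\gamma_i:=1/\alpha_i$, $-1/\alpha_i$, $0$ if $H_i=\Phi_{\alpha_i}$, $\Psi_{\alpha_i}$, $\Lambda$ (i.e. $F_i\in MDA(\Phi_{\alpha_i})$, $MDA(\Psi_{\alpha_i})$, $MDA(\Lambda)$), respectively; and $\delta_i:=\ln\mathcal{Z}$ if $F_i\in MDA(\Lambda)$, $\delta_i:=0$ otherwise.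
   Context: $X_{1:n}\le\cdots\le X_{n:n}$ denote the order statistics of $X_1,\ldots,X_n$, and $Y_{1:n}\le\cdots\le Y_{n:n}$ those of $Y_1,\ldots,Y_n$ (ordering is done separately in each component); $X_{i:N(t)}$, $Y_{i:N(t)}$ are the same with the random sample size $N(t)$. A counting process here means a stochastic process with values in the non-negative integers ($N(t)$ counts claims in $[0,t]$). The randomly indexed order statistics are considered on the event $\{N(t)\ge m\}$, whose probability tends to $1$; values elsewhere are irrelevant. Standard extreme value distributions: $\Phi_\alpha(x)=\exp(-x^{-\alpha})$, $x>0$ (Fréchet; $0$ for $x\le 0$); $\Psi_\alpha(x)=\exp(-|x|^{\alpha})$, $x<0$ (Weibull; $1$ for $x\ge0$); $\Lambda(x)=\exp(-\exp(-x))$, $x\in\mathbb{R}$ (Gumbel); $\alpha>0$. A distribution function $G$ is in $MDA(H)$ (max-domain of attraction of $H$) if $G^t$, after suitable affine normalisation of its argument(s) with positive scale functions, converges to $H$ as $t\to\infty$. Condition (ii) implies $F_i\in MDA(H_i)$ with normalising functions $a_i,b_i$. $\stackrel{d}{\to}$ is convergence in distribution. *)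

(* Defs.v *)
From HB Require Import structures.
From mathcomp Require Import all_boot all_order all_algebra.
From mathcomp Require Import all_classical all_reals all_analysis.

Set Implicit Arguments.
Unset Strict Implicit.
Unset Printing Implicit Defensive.

Import Order.TTheory GRing.Theory Num.Theory.
Import numFieldNormedType.Exports.

Local Open Scope classical_set_scope.
Local Open Scope ring_scope.

Section Probability.
Context (R : realType).

(* Weak convergence: E f(U_i) --> E f(L) for every bounded continuous f.
   The variables U_i and the limit L may live on different spaces. *)
Definition cvg_in_distribution d d' (T : measurableType d)
    (T' : measurableType d') (P : probability T R) (P' : probability T' R)
    (V : topologicalType) (I : Type) (U : I -> T -> V) (Fi : set_system I)
    (L : T' -> V) : Prop :=
  forall f : V -> R, continuous f -> bounded_fun f ->
    (fun i => 'E_P[f \o U i])%E @ Fi --> ('E_P'[f \o L])%E.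

Definition process_sigma (T I : Type) d (S : measurableType d)
    (D : set I) (U : I -> T -> S) : set_system T :=
  <<s \bigcup_(i in D) preimage_set_system setT (U i) measurable >>.

Definition independent_processes d (T : measurableType d)
    (P : probability T R) (I I' : Type)
    d1 (S : measurableType d1) d2 (S' : measurableType d2)
    (D : set I) (U : I -> T -> S) (D' : set I') (V : I' -> T -> S') : Prop :=
  forall A B, process_sigma D U A -> process_sigma D' V B ->
    (P (A `&` B) = P A * P B)%E.

Definition joint_cdf d (T : measurableType d) (P : probability T R)
    (X Y : T -> R) (x y : R) : R :=
  fine (P [set w | X w <= x /\ Y w <= y]).

Definition bivariate_df (H : R -> R -> R) : Prop :=
  exists mu : probability (R * R)%type R, forall x y, H x y = joint_cdf mu fst snd x y.

Definition marginals (H : R -> R -> R) (H1 H2 : R -> R) : Prop :=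
  (forall x, H x y @[y --> +oo] --> H1 x) /\
  (forall y, H x y @[x --> +oo] --> H2 y).

Definition max_stable (H : R -> R -> R) : Prop :=
  forall n : nat, (0 < n)%N -> exists A1 B1 A2 B2 : R,
    [/\ 0 < A1, 0 < A2 &
        forall x y, H (A1 * x + B1) (A2 * y + B2) ^+ n = H x y].

End Probability.

Inductive extreme_value_law (R : realType) :=
  | Frechet of {posnum R}
  | Weibull of {posnum R}
  | Gumbel.
Arguments Gumbel {R}.

Section ExtremeValue.
Context (R : realType).
Implicit Type h : extreme_value_law R.

Definition ev_df h (x : R) : R :=
  match h with
  | Frechet alpha => if 0 < x then expR (- x `^ (- alpha%:num)) else 0
  | Weibull alpha => if x < 0 then expR (- `|x| `^ alpha%:num) else 1
  | Gumbel => expR (- expR (- x))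
  end.

Definition ev_gamma h : R :=
  match h with
  | Frechet alpha => alpha%:num^-1
  | Weibull alpha => - alpha%:num^-1
  | Gumbel => 0
  end.

Definition ev_delta h (z : R) : R :=
  if h is Gumbel then ln z else 0.

(* With x k standing for X_{k+1}, this is X_{i:n} for 1 <= i <= n; outside
   that range the value is junk. *)
Definition order_stat (x : nat -> R) (i n : nat) : R :=
  nth 0 (sort <=%R (mkseq x n)) i.-1.

(* An m-tuple of pairs (x_j, y_j), as an element of R^(m x 2) with its
   product topology. *)
Definition pairs_mx m (x y : 'I_m -> R) : 'M[R]_(m, 2) :=
  \matrix_(j, k) if k == ord0 then x j else y j.

(* ((X_{n-j+1:n} - b1) / a1, (Y_{n-j+1:n} - b2) / a2) for j = 1, ..., m; the
   ordinal index j : 'I_m is 0-based.  Only meaningful when m <= n. *)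
Definition upper_order_stats m (x y : nat -> R) (n : nat) (a1 b1 a2 b2 : R) :
    'M[R]_(m, 2) :=
  pairs_mx (fun j : 'I_m => (order_stat x (n - j.+1).+1 n - b1) / a1)
           (fun j : 'I_m => (order_stat y (n - j.+1).+1 n - b2) / a2).

End ExtremeValue.

(* Main.v *)
(** Conditioning on the sample size reduces everything to the deterministic
    quantities u(t,n) = E f(statistics of size n, normalised at t) and
    g(z) = E f(z^gamma_1 X + delta_1(z), z^gamma_2 Y + delta_2(z)): independence
    and Fubini turn the two sides of the claim into E u(t, N(t)) and E g(Z).
    Changing the normalisation from n to t is an affine map, whose coefficients
    converge when n / t -> s > 0: comparing F_i^(ts) at the normalisations t and
    ts gives a_i(ts) / a_i(t) -> s^gamma_i and (b_i(ts) - b_i(t)) / a_i(t) ->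
    delta_i(s), because H_i(s^gamma_i x + delta_i(s))^s = H_i(x).  Together with
    tightness of the normalised statistics this yields u(t,n) - g(n/t) -> 0
    locally uniformly in n/t in (0, oo), and a cutoff away from 0 and oo, which
    carries almost all the mass of Z, finishes the proof. *)
Require Import Defs.
From HB Require Import structures.
From mathcomp Require Import all_boot all_order all_algebra.
From mathcomp Require Import all_classical all_reals all_analysis.
From mathcomp Require Import measurable_realfun ring lra.

Set Implicit Arguments.
Unset Strict Implicit.
Unset Printing Implicit Defensive.

Import Order.TTheory GRing.Theory Num.Theory.
Import numFieldNormedType.Exports.

Local Open Scope classical_set_scope.
Local Open Scope ring_scope.

(** * Integrals of bounded functions against a probability *)

Section BoundedExpectation.
Context (R : realType) d (T : measurableType d) (P : probability T R).
Implicit Types (f g h : T -> R) (M : R).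

Lemma integrable_of_bound f M : measurable_fun setT f ->
  (forall w, `|f w| <= M) -> P.-integrable setT (EFin \o f).
Proof.
move=> mf fM; apply: measurable_bounded_integrable => //.
  by rewrite -ge0_fin_numE// fin_num_measure.
exists M; split; first exact: num_real.
by move=> x Mx w _; exact: le_trans (fM w) (ltW Mx).
Qed.

Lemma expectation_Rintegral f M : measurable_fun setT f ->
  (forall w, `|f w| <= M) -> 'E_P[f]%E = (\int[P]_w f w)%:E.
Proof.
move=> mf fM; rewrite unlock /Rintegral fineK//.
exact: integrable_fin_num (integrable_of_bound mf fM).
Qed.

Lemma Rintegral_probability_cst (k : R) : \int[P]_w k = k.
Proof.
rewrite Rintegral_cst// -[RHS]mulr1; congr (_ * _).
exact: (congr1 fine (probability_setT P)).
Qed.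

Lemma le_Rintegral_cst f M : measurable_fun setT f ->
  (forall w, `|f w| <= M) -> `|\int[P]_w f w| <= M.
Proof.
move=> mf fM; have If := integrable_of_bound mf fM.
rewrite -[leRHS]Rintegral_probability_cst; apply: le_trans (le_normr_Rintegral _ If) _ => //.
apply: le_Rintegral => //.
- by apply: (@integrable_of_bound _ M);
    [exact: measurableT_comp|move=> w; rewrite normr_id].
- by apply: (@integrable_of_bound _ `|M|).
Qed.

Lemma Rintegral_dist f g h M : measurable_fun setT f -> measurable_fun setT g ->
  measurable_fun setT h ->
  (forall w, `|f w| <= M) -> (forall w, `|g w| <= M) -> (forall w, `|h w| <= M) ->
  (forall w, `|f w - g w| <= h w) ->
  `|\int[P]_w f w - \int[P]_w g w| <= \int[P]_w h w.
Proof.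
move=> mf mg mh fM gM hM fgh.
have If := integrable_of_bound mf fM; have Ig := integrable_of_bound mg gM.
have Ih := integrable_of_bound mh hM.
have mB : measurable_fun setT (fun w => f w - g w) by exact: measurable_funB.
have BM w : `|f w - g w| <= M by exact: le_trans (fgh w) (le_trans (ler_norm _) (hM w)).
have IB := integrable_of_bound mB BM.
rewrite -RintegralB//; apply: le_trans (le_normr_Rintegral _ IB) _ => //.
apply: le_Rintegral => //.
by apply: (@integrable_of_bound _ M);
  [exact: measurableT_comp|move=> w; rewrite normr_id].
Qed.

End BoundedExpectation.

(** * Fubini for a random variable independent of a family *)

Section IndependentFubini.
Context (R : realType) d (T : measurableType d) (P : probability T R).
Context (I I' : Type) d1 (S : measurableType d1) d2 (S' : measurableType d2).
Variables (D : set I) (U : I -> T -> S) (D' : set I') (V : I' -> T -> S').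

(** Carrying the generated sigma-algebra on the sample space itself turns the whole family [V] into
    a single random element, so no product space over the index set is needed. *)
Local Notation TV := (g_sigma_algebraType
  (\bigcup_(i in D') preimage_set_system setT (V i) measurable)).

Lemma measurable_process i : D' i -> measurable_fun setT (V i : TV -> S').
Proof.
by move=> D'i _ B mB; apply: sub_sigma_algebra; exists i => //; exists B.
Qed.

Hypothesis mV : forall i, D' i -> measurable_fun setT (V i).

Let mid : measurable_fun setT (id : T -> TV).
Proof.
move=> _ B mB; rewrite setTI preimage_id.
suff: process_sigma D' V `<=` measurable by exact.
apply: smallest_sub; first exact: sigma_algebra_measurable.
by move=> A [i D'i] [C mC <-]; exact: mV.
Qed.

Variables (i0 : I) (Di0 : D i0).
Hypothesis mU : measurable_fun setT (U i0).
Hypothesis indep : independent_processes P D U D' V.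

(* The second family enters through the identity onto T with the sigma-algebra
   it generates: independence says that (U i0, id) has a product law. *)
Lemma independent_Fubini (phi : S * TV -> R) (M : R) :
  measurable_fun setT phi -> (forall z, `|phi z| <= M) ->
  measurable_fun setT (fun x => \int[P]_w phi (x, w)) /\
  \int[P]_w phi (U i0 w, w) = \int[P]_w \int[P]_w' phi (U i0 w, w').
Proof.
move=> mphi phiM.
pose Ui : {mfun T >-> S} := mfun_Sub (mem_set mU).
pose idV : {mfun T >-> TV} := mfun_Sub (mem_set mid).
have mpr : measurable_fun setT (fun w => (U i0 w, w) : (S * TV)%type).
  exact: measurable_fun_pair.
pose pr : {mfun T >-> (S * TV)%type} := mfun_Sub (mem_set mpr).
pose mu1 := distribution P Ui; pose mu2 := distribution P idV.
have mphi1 : measurable_fun setT (EFin \o phi) by exact/measurable_EFinP.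
(* By independence the joint law and the product law agree on measurable rectangles, and rectangles
   determine the product measure. *)
have prE A : measurable A -> (mu1 \x mu2)%E A = distribution P pr A.
  move=> mA; apply: product_measure_unique => // {mA}A B mA mB.
  rewrite /= /distribution /pushforward/=.
  rewrite (_ : pr @^-1` _ = U i0 @^-1` A `&` B); last by apply/seteqP; split => w [].
  by apply: indep => //; apply: sub_sigma_algebra; exists i0 => //; exists A => //; rewrite setTI.
have Iphi : (mu1 \x mu2)%E.-integrable setT (EFin \o phi).
  exact: (@integrable_of_bound _ _ _ (mu1 \x mu2)%E _ M).
have inner x : (\int[mu2]_y (phi (x, y))%:E = (\int[P]_w phi (x, w))%:E)%E.
  have mx : measurable_fun setT (fun y : TV => phi (x, y)).
    exact: measurable_fun_pair2.
  have mxT : measurable_fun setT (fun w : T => phi (x, w)).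
    exact: (measurableT_comp mx mid).
  have Ix : P.-integrable setT (EFin \o (fun w : T => phi (x, w))).
    exact: (@integrable_of_bound _ _ _ P _ M).
  rewrite integral_distribution//; last exact/measurable_EFinP.
  by rewrite /Rintegral fineK//; exact: integrable_fin_num.
have mF : measurable_fun setT (fun x => (\int[P]_w phi (x, w))%:E).
  rewrite (_ : (fun _ => _) = fubini_F mu2 (EFin \o phi)).
    exact: measurable_fubini_F Iphi.
  by apply/funext => x; apply/esym; exact: inner.
have mI : measurable_fun setT (fun x => \int[P]_w phi (x, w)).
  exact/measurable_EFinP.
split => //; rewrite /Rintegral; congr fine.
transitivity (\int[distribution P pr]_z (phi z)%:E)%E.
  rewrite integral_distribution//.
  apply: (@integrable_of_bound _ _ _ P (phi \o pr) M) => [|w]; last exact: phiM.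
  exact: (measurableT_comp mphi mpr).
rewrite (eq_measure_integral (mu1 \x mu2)%E); last by move=> A mA _; apply/esym; exact: prE.
rewrite -integral12_prod_meas1//.
transitivity (\int[mu1]_x (\int[P]_w phi (x, w))%:E)%E.
  by apply: eq_integral => x _; exact: inner.
rewrite integral_distribution//.
apply: (@integrable_of_bound _ _ _ P (fun w => \int[P]_w' phi (U i0 w, w')) M).
  exact: (measurableT_comp mI mU).
move=> w; apply: le_Rintegral_cst => //.
exact: (measurableT_comp (measurable_fun_pair2 _ mphi) mid).
Qed.

End IndependentFubini.

(** * Convergence and compactness in spaces of matrices *)

Section MatrixTopology.
Context {m n : nat}.

Lemma cvg_mx {T : topologicalType} {I : Type} {F : set_system I} {FF : Filter F}
    (u : I -> 'M[T]_(m, n)) (M : 'M[T]_(m, n)) :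
  (forall i j, u x i j @[x --> F] --> M i j) -> u x @[x --> F] --> M.
Proof.
move=> uM A [B MB BA].
suff : \forall x \near F, forall ij : 'I_m * 'I_n, B ij.1 ij.2 (u x ij.1 ij.2).
  by apply: filterS => x Bx; apply: BA => i j; exact: (Bx (i, j)).
by apply: filter_forall => -[i j]; exact: uM (MB i j).
Qed.

(** The box is the image, under the continuous map [vec_mx], of a compact box of row vectors. *)
Lemma compact_mx_box (R : realType) (K : R) :
  compact [set M : 'M[R]_(m, n) | forall i j, `|M i j| <= K].
Proof.
have cB := @rV_compact R (m * n) (fun=> `[- K, K]%classic)
  (fun=> @segment_compact R _ _).
rewrite (_ : [set M | _] =
    vec_mx @` [set v : 'rV[R]_(m * n) | forall i, `[- K, K]%classic (v ord0 i)]).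
  apply: continuous_compact => //; apply: continuous_subspaceT => v.
  apply: (@cvg_mx R _ (nbhs v)) => i j; rewrite mxE; under eq_fun do rewrite mxE.
  exact: coord_continuous.
apply/seteqP; split => [M MK|_ [v vK <-] i j].
  exists (mxvec M); last by rewrite mxvecK.
  by move=> k /=; case/mxvec_indexP: k => i j; rewrite mxvecE in_itv/= -ler_norml.
by rewrite mxE; have := vK (mxvec_index i j); rewrite /= in_itv/= -ler_norml.
Qed.

(** The l1 norm serves as the continuous function with compact sublevel sets in the tightness
    argument. The sum runs over an explicit list so that continuity goes by induction on that
    list. *)
Definition mx_l1 (R : realType) (M : 'M[R]_(m, n)) : R :=
  \sum_(ij <- index_enum ('I_m * 'I_n)%type) `|M ij.1 ij.2|.

Lemma mx_l1_continuous (R : realType) : continuous (@mx_l1 R).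
Proof.
rewrite /mx_l1; elim: index_enum => [|ij r IH].
  rewrite (_ : (fun _ => _) = cst 0); first exact: cst_continuous.
  by apply/funext => M; rewrite big_nil.
rewrite (_ : (fun _ => _) = fun M : 'M[R]_(m, n) =>
    `|M ij.1 ij.2| + \sum_(ij <- r) `|M ij.1 ij.2|); last first.
  by apply/funext => M; rewrite big_cons.
move=> M; apply: (@cvgD _ _ _ (nbhs M)); last exact: IH.
apply: (@cvg_norm _ _ _ (nbhs M)); exact: coord_continuous.
Qed.

Lemma mx_l1_compact (R : realType) (K : R) : compact [set M | mx_l1 M <= K].
Proof.
apply: (subclosed_compact _ (@compact_mx_box R K)).
  apply: (@preimage_closed _ _ (@mx_l1 R) [set x | x <= K]); last exact: closed_le.
  by move=> M _; exact: mx_l1_continuous.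
move=> M /= MK i j; apply: le_trans MK.
by rewrite /mx_l1 (bigD1 (i, j))//= lerDl; apply: sumr_ge0 => ij _; exact: normr_ge0.
Qed.

End MatrixTopology.

(** * Measurability of continuous functions of random matrices *)

Section MeasurableMatrix.
Context (R : realType) d (T : measurableType d) (m n : nat).

(** Preimages are cut along the countably many values of [c]; on each piece the function is a fixed
    [f a]. This handles rounded matrices and random sample sizes alike. *)
Lemma measurable_fun_countable d' (S : measurableType d') (C : countType)
    (c : T -> C) (f : C -> T -> S) :
  (forall a, measurable (c @^-1` [set a])) ->
  (forall a, measurable_fun setT (f a)) ->
  measurable_fun setT (fun w => f (c w) w).
Proof.
move=> mc mf _ B mB; rewrite setTI.
rewrite (_ : _ @^-1` B = \bigcup_(a in [set: C]) (c @^-1` [set a] `&` f a @^-1` B)).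
  apply: countable_bigcupT_measurable => // a.
  by apply: measurableI => //; rewrite -[X in measurable X]setTI; exact: mf.
by apply/seteqP; split => [w fB|w [a _ [/= <-]]//]; exists (c w).
Qed.

(* The entries are rounded down to multiples of [1 / k.+1]: the rounded matrix
   takes countably many values and tends to [U w]. *)
Lemma measurable_fun_mx (U : T -> 'M[R]_(m, n)) (f : 'M[R]_(m, n) -> R) :
  (forall i j, measurable_fun setT (fun w => U w i j)) -> continuous f ->
  measurable_fun setT (f \o U).
Proof.
move=> mU cf.
pose r k w : 'M[int]_(m, n) := \matrix_(i, j) Num.floor (k.+1%:R * U w i j).
pose q k (M : 'M[int]_(m, n)) : 'M[R]_(m, n) := \matrix_(i, j) ((M i j)%:~R / k.+1%:R).
apply: (@measurable_fun_cvg _ _ _ _ (fun k w => f (q k (r k w)))) => [k|w _].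
  apply: (@measurable_fun_countable _ _ _ (r k) (fun M _ => f (q k M))) => // M.
  rewrite (_ : _ @^-1` _ = \bigcap_(ij in [set: 'I_m * 'I_n])
      (fun w => U w ij.1 ij.2) @^-1`
      `[(M ij.1 ij.2)%:~R / k.+1%:R, (M ij.1 ij.2 + 1)%:~R / k.+1%:R[).
    apply: fin_bigcap_measurable => // -[i j] _.
    by rewrite -[X in measurable X]setTI; exact: mU.
  (* Fixing a rounded entry confines the original entry to a half-open interval, so the level sets
     of the rounded matrix are finite intersections of measurable sets. *)
  have fE (x : R) (z : int) : (Num.floor (k.+1%:R * x) == z) =
      (x \in `[z%:~R / k.+1%:R, (z + 1)%:~R / k.+1%:R[).
    by rewrite floor_eq in_itv/= ler_pdivrMr// ltr_pdivlMr// mulrC.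
  apply/seteqP; split => [w /= rM [i j] _ /=|w /= wM].
    by rewrite /= -fE -rM mxE.
  by apply/matrixP => i j; rewrite mxE; apply/eqP; rewrite fE; apply: (wM (i, j)).
apply: continuous_cvg; first exact: cf.
apply: (@cvg_mx _ _ R _ \oo) => i j.
under eq_fun do rewrite 2!mxE.
apply: (@squeeze_cvgr _ _ _ _ (fun k => U w i j - k.+1%:R^-1) (fun=> U w i j)).
- near=> k; apply/andP; split.
    rewrite ler_pdivlMr// mulrBl mulVf// mulrC; apply/ltW.
    by rewrite ltrBlDr -intrD1; exact: floorD1_gt.
  by rewrite ler_pdivrMr// mulrC; exact: floor_le.
- rewrite -[X in _ --> X]subr0; apply: cvgB; first exact: cvg_cst.
  exact: cvg_harmonic.
- exact: cvg_cst.
Unshelve. all: by end_near. Qed.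

End MeasurableMatrix.

(** * Measurability of order statistics *)

Section OrderStatistics.
Context (R : realType).

(** Replaces events on an order statistic by events on the number of sample points below a level, a
    count that ignores the sorting. *)
Lemma sorted_nth_le (s : seq R) (k : nat) (c : R) : sorted <=%R s ->
  (k < size s)%N -> (nth 0 s k <= c) = (k < count (fun x => (x <= c)%R) s)%N.
Proof.
elim: s k => // x s IH k /= xs; have ss := path_sorted xs.
have xle y : y \in s -> x <= y by move: y; apply/allP/order_path_min => //; exact: le_trans.
case: k => [_|k ks] /=.
  case: leP => //= cx; rewrite add0n; apply/esym/negbTE; rewrite -leqNgt leqn0.
  rewrite eqn0Ngt -has_count; apply/hasPn => y /xle xy.
  by rewrite -ltNge (lt_le_trans cx).
rewrite IH//; case: leP => [_|cx] /=; first by rewrite add1n ltnS.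
rewrite add0n (_ : count _ s = 0%N)//.
apply/eqP; rewrite eqn0Ngt -has_count; apply/hasPn => y /xle xy.
by rewrite -ltNge (lt_le_trans cx).
Qed.

Context d (T : measurableType d) (X : nat -> T -> R).
Hypothesis mX : forall n, measurable_fun setT (X n).

(** Induction on the sample size: the last point contributes one or nothing to the count, according
    to a measurable event. *)
Lemma measurable_count_le (n k : nat) (c : R) :
  measurable [set w | (k < count (fun x => (x <= c)%R) (mkseq (X ^~ w) n))%N].
Proof.
have mC i : measurable [set w | X i w <= c].
  rewrite (_ : mkset _ = X i @^-1` `]-oo, c]).
    by rewrite -[X in measurable X]setTI; exact: mX.
  by apply/seteqP; split => w /=; rewrite in_itv.
elim: n k => [|n IH] k; first by rewrite (_ : mkset _ = set0)// -subset0 => w.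
rewrite (_ : mkset _ =
  [set w | (k < count (fun x => (x <= c)%R) (mkseq (X ^~ w) n))%N] `|`
  ([set w | X n w <= c] `&`
   [set w | (k <= count (fun x => (x <= c)%R) (mkseq (X ^~ w) n))%N])).
  apply: measurableU => //; apply: measurableI => //.
  case: k => [|k]; last exact: IH.
  by rewrite (_ : mkset _ = setT) ?(@measurableT _ T)// -subTset => w.
have cS w : count (fun x => (x <= c)%R) (mkseq (X ^~ w) n.+1) =
    (count (fun x => (x <= c)%R) (mkseq (X ^~ w) n) + (X n w <= c)%R)%N.
  by rewrite mkseqS -cats1 count_cat/= addn0.
apply/seteqP; split => w; rewrite /setU /setI /mkset cS;
  case: (X n w <= c); rewrite ?addn0 ?addn1 ?ltnS.
- by move=> H; right.
- by move=> H; left.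
- by case=> [/ltnW|[]].
- by case=> [|[]].
Qed.

Lemma measurable_order_stat (i n : nat) :
  measurable_fun setT (fun w => order_stat (X ^~ w) i n).
Proof.
rewrite /order_stat; have [ni|ni] := leqP n i.-1.
  (* An index beyond the sample size returns the default value 0 of [nth]. *)
  rewrite (_ : (fun _ => _) = cst 0); first exact: measurable_cst.
  by apply/funext => w; rewrite nth_default// size_sort size_mkseq.
apply: (measurability _ (RGenOInfty.measurableE R)) => //.
move=> /= _ [_ [c ->] <-]; rewrite setTI.
rewrite (_ : _ @^-1` _ =
  ~` [set w | (i.-1 < count (fun x => (x <= c)%R) (mkseq (X ^~ w) n))%N]).
  by apply: measurableC; exact: measurable_count_le.
apply/seteqP; split => w /=; rewrite in_itv/= andbT ltNge sorted_nth_le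
  ?sort_le_sorted ?size_sort ?size_mkseq// count_sort => /negP//.
Qed.

End OrderStatistics.

(** * Standard extreme value distributions *)

Section ExtremeValueLaws.
Context (R : realType).
Implicit Types (h : extreme_value_law R) (s x y : R).

Lemma expR_powR x s : expR x `^ s = expR (s * x).
Proof. by rewrite /powR gt_eqF ?expR_gt0// expRK. Qed.

(** For v > 0 this is continuity of exp and ln. For v = 0 the exponents eventually exceed s / 2, and
    since bases lie in [0, 1] the power is at most u^(s / 2), which tends to 0. *)
Lemma cvg_powR {I : Type} {F : set_system I} {FF : Filter F} (u r : I -> R) (v s : R) :
  0 < s -> (\forall i \near F, 0 <= u i <= 1) -> 0 <= v -> u i @[i --> F] --> v ->
  r i @[i --> F] --> s -> u i `^ r i @[i --> F] --> v `^ s.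
Proof.
move=> s0 u01 v0 uv rs; move: v0; rewrite le_eqVlt => /predU1P[v0|v0]; last first.
  rewrite {2}/powR gt_eqF//.
  have ucvg : expR (r i * ln (u i)) @[i --> F] --> expR (s * ln v).
    apply: continuous_cvg; first exact: continuous_expR.
    apply: cvgM => //; apply: continuous_cvg => //; exact: continuous_ln.
  apply: cvg_trans ucvg; apply: near_eq_cvg; near=> i.
  rewrite /powR gt_eqF//; near: i; exact: (cvgr_gt _ uv).
rewrite -{}v0 powR0 ?gt_eqF// in uv *.
apply/cvgrPdist_le => e e0.
(* The threshold for the base is chosen so that its power s / 2 is exactly e. *)
have e'0 : 0 < e `^ (2 / s) by exact: powR_gt0.
near=> i.
have /andP[ui0 ui1] : 0 <= u i <= 1 by near: i.
have ri : s / 2 <= r i.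
  by near: i; apply: (cvgr_ge _ rs); rewrite ltr_pdivrMr// mulr2n mulrDr mulr1 ltrDl.
rewrite sub0r normrN ger0_norm ?powR_ge0//.
move: ui0; rewrite le_eqVlt => /predU1P[<-|ui0].
  by rewrite powR0 ?(ltW e0)// gt_eqF// (lt_le_trans _ ri)// divr_gt0.
apply: le_trans (ger_powR _ ri) _; first by rewrite ui0.
have -> : e = (e `^ (2 / s)) `^ (s / 2).
  rewrite -powRrM (_ : _ / _ * _ = 1) ?powRr1// ?ltW//.
  by rewrite mulrA divfK ?gt_eqF// divff.
apply: ge0_ler_powR; rewrite ?nnegrE ?divr_ge0 ?powR_ge0// ?ltW//.
by near: i; exact: (cvgr_lt _ uv).
Unshelve. all: by end_near. Qed.

Lemma ev_df_ge0 h x : 0 <= ev_df h x.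
Proof. by case: h => [a|a|] /=; [case: ifP|case: ifP|] => *; rewrite ?expR_ge0. Qed.

(** The affine map is the one that multiplies the exponent of the law by 1 / s, which the outer
    power s cancels; off the support the value is 0 or 1, fixed by powers. *)
Lemma ev_df_rescale h s x : 0 < s ->
  ev_df h (s `^ ev_gamma h * x + ev_delta h s) `^ s = ev_df h x.
Proof.
move=> s0; case: h => [a|a|] /=; rewrite ?addr0.
- rewrite pmulr_rgt0 ?powR_gt0//; case: ifPn => [x0|_]; last by rewrite powR0 ?gt_eqF.
  have sE : (s `^ a%:num^-1) `^ (- a%:num) = s^-1.
    by rewrite -powRrM mulrN mulVf// powR_inv1// ltW.
  by rewrite expR_powR powRM ?powR_ge0 ?(ltW x0)// sE mulrN mulrA divff ?gt_eqF// mul1r.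
- rewrite pmulr_rlt0 ?powR_gt0//; case: ifPn => [x0|_]; last by rewrite powR1.
  have sE : (s `^ (- a%:num^-1)) `^ a%:num = s^-1.
    by rewrite -powRrM mulNr mulVf// powR_inv1// ltW.
  rewrite expR_powR normrM powRM ?normr_ge0// ger0_norm ?powR_ge0//.
  by rewrite sE mulrN mulrA divff ?gt_eqF// mul1r.
- rewrite powRr0 mul1r expR_powR opprD expRD [expR (- ln s)]expRN lnK ?posrE//.
  by rewrite mulrN mulrCA divff ?gt_eqF// mulr1.
Qed.

(** A standard law is strictly increasing where it is neither 0 nor 1, and one interior value
    suffices. The disjunction lets a fixed interior point be compared with points on either side. *)
Lemma ev_df_lt h x y : x < y ->
  (0 < ev_df h x < 1) \/ (0 < ev_df h y < 1) -> ev_df h x < ev_df h y.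
Proof.
move=> xy; case: h => [a|a|] /=.
- case: (ltP 0 x) => x0; last by rewrite ltxx/=; case=> // /andP[].
  rewrite (lt_trans x0 xy) => _; rewrite ltr_expR ltrN2 !powRN.
  rewrite ltf_pV2 ?posrE ?powR_gt0// ?(lt_trans x0 xy)//.
  by apply: gt0_ltr_powR => //; rewrite nnegrE ltW// (lt_trans x0).
- case: (ltP y 0) => y0.
    rewrite (lt_trans xy y0) => _; rewrite ltr_expR ltrN2.
    apply: gt0_ltr_powR => //; rewrite ?nnegrE//.
    by rewrite !ltr0_norm// ?ltrN2// (lt_trans xy).
  by case: ltP => // x0; rewrite ltxx ?andbF; case=> // /andP[].
- by rewrite !ltr_expR ltrN2 ltr_expR ltrN2.
Qed.

(** Two points are wanted because an affine map is determined by its values at two points. *)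
Lemma ev_df_interior h : exists x y, [/\ x < y, 0 < ev_df h x < 1 & 0 < ev_df h y < 1].
Proof.
have e01 z : 0 < z -> 0 < expR (- z) < 1 by move=> z0; rewrite expR_gt0 expR_lt1 oppr_lt0.
case: h => [a|a|]; [exists 1, 2|exists (-2), (-1)|exists 0, 1]; rewrite /=.
- by rewrite ltr01 !ltr0n ltr1n; split=> //; apply: e01; rewrite powR_gt0.
- rewrite ltrN2 ltr1n !oppr_lt0 ltr01 !ltr0n; split => //;
    apply: e01; rewrite powR_gt0// normr_gt0 oppr_eq0.
    by rewrite pnatr_eq0.
  by rewrite oner_eq0.
- by split; rewrite ?ltr01//; apply: e01; exact: expR_gt0.
Qed.

End ExtremeValueLaws.

(** * Convergence of types, locally uniformly in the time ratio *)

Lemma cvg_snd_mul_fst (R : realType) (s : R) : 0 < s ->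
  p.2 * p.1 @[p --> filter_prod (nbhs s) (pinfty_nbhs R)] --> +oo.
Proof.
move=> s_gt0.
have cvg1 : p.1 @[p --> filter_prod (nbhs s) (pinfty_nbhs R)] --> s by exact: cvg_fst.
have cvg2 : p.2 @[p --> filter_prod (nbhs s) (pinfty_nbhs R)] --> +oo by exact: cvg_snd.
apply/cvgryPge => A; near=> p.
have p1 : s / 2 <= p.1.
  by near: p; apply: (cvgr_ge _ cvg1); rewrite ltr_pdivrMr// mulr2n mulrDr mulr1 ltrDl.
have p2 : `|A| * (2 / s) <= p.2 by near: p; move/cvgryPge : cvg2; exact.
have s2 : 0 < s / 2 by rewrite divr_gt0.
apply: le_trans (ler_norm A) _.
rewrite -[leLHS](_ : `|A| * (2 / s) * (s / 2) = _).
  by apply: ler_pM => //; [rewrite mulr_ge0// divr_ge0// ltW|exact: ltW].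
by rewrite -mulrA (_ : _ / _ * _ = 1) ?mulr1//; field; rewrite gt_eqF.
Unshelve. all: by end_near. Qed.

Section ConvergenceOfTypes.
Context (R : realType) (h : extreme_value_law R) (G a b : R -> R).
Hypothesis G_ge0 : forall x, 0 <= G x.
Hypothesis G_le1 : forall x, G x <= 1.
Hypothesis G_ndecr : {homo G : x y / x <= y}.
Hypothesis a_gt0 : forall t, 0 < t -> 0 < a t.
Hypothesis G_cvg : forall x, G (a t * x + b t) `^ t @[t --> +oo] --> ev_df h x.
Variables (s : R) (s_gt0 : 0 < s).

(** A point is a pair (s', t) with s' near s and t large; limits along [W] hold locally uniformly in
    the ratio s' of the two times t s' and t. *)
Local Notation W := (filter_prod (nbhs s) (pinfty_nbhs R)).
Let c (p : R * R) := a (p.2 * p.1) / a p.2.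
Let e (p : R * R) := (b (p.2 * p.1) - b p.2) / a p.2.

Let cvg1 : p.1 @[p --> W] --> s. Proof. exact: cvg_fst. Qed.
Let cvg2 : p.2 @[p --> W] --> +oo. Proof. exact: cvg_snd. Qed.
Let cvg12 := cvg_snd_mul_fst s_gt0.

Let p_gt0 : \forall p \near W, 0 < p.2 /\ 0 < p.2 * p.1.
Proof.
near=> p; split; near: p; [move/cvgryPgt : cvg2|move/cvgryPgt : cvg12]; exact.
Unshelve. all: by end_near. Qed.

Let argE p x : 0 < p.2 -> a (p.2 * p.1) * x + b (p.2 * p.1) = a p.2 * (c p * x + e p) + b p.2.
Proof.
move=> p0; have := a_gt0 p0; rewrite /c /e => /lt0r_neq0 a0.
by field.
Qed.

(** Write the power t s' as (G^t)^s' and let base and exponent converge together. *)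
Let lhs_cvg y : G (a p.2 * y + b p.2) `^ (p.2 * p.1) @[p --> W] --> ev_df h y `^ s.
Proof.
under eq_fun do rewrite powRrM.
apply: cvg_powR => //; [|exact: ev_df_ge0|exact: (cvg_comp _ _ cvg2 (@G_cvg y))].
near=> p; rewrite powR_ge0/=.
have p20 : 0 < p.2 by near: p; move/cvgryPgt : cvg2; exact.
apply: le_trans (ge0_ler_powR _ _ _ (G_le1 _)) _; rewrite ?nnegrE ?(ltW p20)//.
by rewrite powR1.
Unshelve. all: by end_near. Qed.

(** This is the assumed convergence at time t s', with its normalisation rewritten through that of
    time t. *)
Let rhs_cvg x : G (a p.2 * (c p * x + e p) + b p.2) `^ (p.2 * p.1) @[p --> W] --> ev_df h x.
Proof.
have := cvg_comp _ _ cvg12 (@G_cvg x); apply: cvg_trans; apply: near_eq_cvg.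
by near=> p; rewrite /= -argE//; near: p; apply: filterS p_gt0 => p [].
Unshelve. all: by end_near. Qed.

Let lt_of_powR p y z : 0 < p.2 -> 0 < p.2 * p.1 ->
  G (a p.2 * y + b p.2) `^ (p.2 * p.1) < G (a p.2 * z + b p.2) `^ (p.2 * p.1) -> y < z.
Proof.
move=> p2 p12; apply: contraTT; rewrite -!leNgt => zy.
apply: ge0_ler_powR; rewrite ?nnegrE ?G_ge0 ?(ltW p12)//.
by apply: G_ndecr; rewrite lerD2r ler_pM2l// a_gt0.
Qed.

(* If y < s^gamma x + delta then H(y)^s < H(x), so that eventually
   G(a y + b)^(ts) < G(a (c x + e) + b)^(ts), whence y < c x + e. *)
Let affine_cvg x : 0 < ev_df h x < 1 ->
  c p * x + e p @[p --> W] --> s `^ ev_gamma h * x + ev_delta h s.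
Proof.
move=> x01; set y0 := _ + ev_delta h s.
(* The inverse of x |-> s^gamma x + delta; it absorbs the power s of the law, so that the two limits
   become values of one strictly increasing function. *)
pose inv y := (y - ev_delta h s) / s `^ ev_gamma h.
have sg0 : 0 < s `^ ev_gamma h by exact: powR_gt0.
have invE y : ev_df h y `^ s = ev_df h (inv y).
  have yE : y = s `^ ev_gamma h * inv y + ev_delta h s.
    by rewrite /inv mulrC divfK ?lt0r_neq0// subrK.
  by rewrite {1}yE; exact: ev_df_rescale.
have inv0 : inv y0 = x by rewrite /inv /y0 addrK mulrC mulKf// lt0r_neq0.
have inv_lt y z : y < z -> inv y < inv z.
  by move=> yz; rewrite /inv ltr_pM2r ?invr_gt0// ltrD2r.
have lo y : y < y0 -> \forall p \near W, y < c p * x + e p.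
  move=> yy0; have yx : ev_df h y `^ s < ev_df h x.
    by rewrite invE; apply: ev_df_lt; [rewrite -inv0; exact: inv_lt|right].
  (* The midpoint of the two distinct limits eventually separates the two powers of G. *)
  have ym : \forall p \near W,
      G (a p.2 * y + b p.2) `^ (p.2 * p.1) < (ev_df h y `^ s + ev_df h x) / 2.
    by have /cvgr_lt := @lhs_cvg y; apply; exact: (midf_lt yx).1.
  have mx : \forall p \near W,
      (ev_df h y `^ s + ev_df h x) / 2 < G (a p.2 * (c p * x + e p) + b p.2) `^ (p.2 * p.1).
    by have /cvgr_gt := @rhs_cvg x; apply; exact: (midf_lt yx).2.
  near=> p; have [p2 p12] : 0 < p.2 /\ 0 < p.2 * p.1 by near: p.
  apply: (lt_of_powR p2 p12); apply: lt_trans (_ : _ < _) (_ : _ < _).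
    by near: p; exact: ym.
  by near: p; exact: mx.
have hi y : y0 < y -> \forall p \near W, c p * x + e p < y.
  move=> yy0; have yx : ev_df h x < ev_df h y `^ s.
    by rewrite invE; apply: ev_df_lt; [rewrite -inv0; exact: inv_lt|left].
  have ym : \forall p \near W,
      (ev_df h x + ev_df h y `^ s) / 2 < G (a p.2 * y + b p.2) `^ (p.2 * p.1).
    by have /cvgr_gt := @lhs_cvg y; apply; exact: (midf_lt yx).2.
  have mx : \forall p \near W,
      G (a p.2 * (c p * x + e p) + b p.2) `^ (p.2 * p.1) < (ev_df h x + ev_df h y `^ s) / 2.
    by have /cvgr_lt := @rhs_cvg x; apply; exact: (midf_lt yx).1.
  near=> p; have [p2 p12] : 0 < p.2 /\ 0 < p.2 * p.1 by near: p.
  apply: (lt_of_powR p2 p12); apply: lt_trans (_ : _ < _) (_ : _ < _).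
    by near: p; exact: mx.
  by near: p; exact: ym.
apply/cvgrPdist_lt => eps eps0; near=> p.
rewrite distrC ltr_distl; apply/andP; split; near: p.
  by apply: lo; rewrite ltrBlDr ltrDl.
by apply: hi; rewrite ltrDl.
Unshelve. all: by end_near. Qed.

(** Convergence of c x + e at two distinct points gives that of the slope c, as a difference
    quotient, and then of e. *)
Lemma cvg_scale_location :
  (c p @[p --> W] --> s `^ ev_gamma h) /\ (e p @[p --> W] --> ev_delta h s).
Proof.
have [x [y [xy x01 y01]]] := ev_df_interior h.
have cx := @affine_cvg _ x01; have cy := @affine_cvg _ y01.
have yx : y - x != 0 by rewrite subr_eq0 gt_eqF.
have cc : c p @[p --> W] --> s `^ ev_gamma h.
  have cE : c = (fun p => ((c p * y + e p) - (c p * x + e p)) / (y - x)).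
    by apply/funext => p; field.
  have -> : s `^ ev_gamma h = ((s `^ ev_gamma h * y + ev_delta h s) -
      (s `^ ev_gamma h * x + ev_delta h s)) / (y - x) by field.
  rewrite cE; apply: cvgM; last exact: cvg_cst.
  exact: cvgB.
split => //.
have eE : e = (fun p => (c p * x + e p) - c p * x).
  by apply/funext => p; rewrite addrAC subrr add0r.
have -> : ev_delta h s = (s `^ ev_gamma h * x + ev_delta h s) - s `^ ev_gamma h * x.
  by rewrite addrAC subrr add0r.
rewrite eE; apply: cvgB => //.
by apply: cvgM => //; exact: cvg_cst.
Qed.

End ConvergenceOfTypes.

(** * Weak convergence with a varying parameter *)

Lemma continuous_pair_section (S U V : topologicalType) (h : S * U -> V) (x : S) :
  continuous h -> continuous (fun y => h (x, y)).
Proof.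
move=> ch y; apply: continuous_comp; last exact: ch.
by apply: cvg_pair; [exact: cvg_cst|exact: cvg_id].
Qed.

Section ConvergenceInDistribution.
Context (R : realType) d d' (T : measurableType d) (T' : measurableType d').
Context (P : probability T R) (P' : probability T' R).
Context (V : topologicalType) (I : Type) (F : set_system I) {FF : Filter F}.
Variables (U : I -> T -> V) (L : T' -> V).
Hypothesis mU : forall i (f : V -> R), continuous f -> measurable_fun setT (f \o U i).
Hypothesis mL : forall f : V -> R, continuous f -> measurable_fun setT (f \o L).

(** Passes from extended-real expectations to real integrals, and from abstract boundedness to an
    explicit bound, the form used in all estimates. *)
Lemma cvg_in_distributionP :
  cvg_in_distribution P P' U F L <->
  (forall (f : V -> R) (M : R), continuous f -> (forall v, `|f v| <= M) ->
    \int[P]_w f (U i w) @[i --> F] --> \int[P']_w f (L w)).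
Proof.
split=> [UL f M cf fM|UL f cf [M [_ fM]]].
  have bf : bounded_fun f.
    by exists M; split; [exact: num_real|move=> x Mx v _; exact: le_trans (fM v) (ltW Mx)].
  have := UL f cf bf.
  rewrite (expectation_Rintegral P' (mL cf) (fun w => fM (L w))).
  under eq_fun do rewrite (expectation_Rintegral P (mU _ cf) (fun w => fM (U _ w))).
  by move/fine_cvgP => [].
have {}fM v : `|f v| <= `|M| + 1 by apply: fM => //; rewrite ltr_pwDr// ler_norm.
rewrite (expectation_Rintegral P' (mL cf) (fun w => fM (L w))).
under eq_fun do rewrite (expectation_Rintegral P (mU _ cf) (fun w => fM (U _ w))).
by apply: cvg_EFin; [exact: nearW|exact: UL fM].
Qed.

Variable rho : V -> R.
Hypothesis rho_continuous : continuous rho.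
Hypothesis rho_compact : forall K, compact [set v | rho v <= K].

(** A continuous ramp, 0 where rho <= K and 1 where rho >= K + 1, so that weak convergence can be
    tested on it. *)
Let psi K v := Num.min 1 (Num.max 0 (rho v - K)).

Let psi_continuous K : continuous (psi K).
Proof.
move=> v; apply: (@continuous_min R V (cst 1) (fun v => Num.max 0 (rho v - K))).
  exact: cvg_cst.
apply: (@continuous_max R V (cst 0) (fun v => rho v - K)); first exact: cvg_cst.
by apply: cvgB; [exact: rho_continuous|exact: cvg_cst].
Qed.

Let psi_ge0 K v : 0 <= psi K v.
Proof. by rewrite le_min ler01 le_max lexx. Qed.

Let psi_le1 K v : psi K v <= 1.
Proof. by rewrite ge_min lexx. Qed.

Let psi_norm K v : `|psi K v| <= 1.
Proof. by rewrite ger0_norm. Qed.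

(** Tightness of the limit law: the ramps tend to 0 pointwise and are dominated by 1. *)
Let psi_tail e : 0 < e -> exists K, \int[P']_w psi K (L w) < e.
Proof.
move=> e0.
have : \int[P']_w psi k%:R (L w) @[k --> \oo] --> (0 : R).
  have [] := @dominated_convergence _ _ _ P' setT measurableT
    (fun k w => (psi k%:R (L w))%:E) (cst 0%E) (cst 1%E).
  - by move=> k; apply/measurable_EFinP; exact: (mL (@psi_continuous k%:R)).
  - exact: measurable_cst.
  - apply: aeW => w _; apply: cvg_near_cst; near=> k.
    congr EFin; rewrite /psi; have -> : Num.max 0 (rho (L w) - k%:R) = 0.
      by apply/max_idPl; rewrite subr_le0; near: k; exact: nbhs_infty_ger.
    by apply/min_idPr; exact: ler01.
  - by apply: (@integrable_of_bound _ _ _ P' (cst 1) 1) => // w; rewrite normr1.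
  - by apply: aeW => w k _; rewrite lee_fin.
  rewrite integral_cst//= mul0e => _ _ /fine_cvgP[_].
  by apply: cvg_trans; apply: near_eq_cvg; near=> k.
move=> /(cvgr_lt _)/(_ e e0)[k _ /(_ k (leqnn k))]; by exists k%:R.
Unshelve. all: by end_near. Qed.

(* By tightness it suffices that h (theta, v) -> h (theta0, v) uniformly on the
   compact sets {rho <= K + 1}; [psi K] dominates the indicator of the rest. *)
Lemma cvg_in_distribution_param (Theta : topologicalType) (h : Theta * V -> R)
    (M : R) (theta0 : Theta) :
  cvg_in_distribution P P' U F L -> continuous h -> (forall z, `|h z| <= M) ->
  \int[P]_w h (p.1, U p.2 w) @[p --> filter_prod (nbhs theta0) F]
    --> \int[P']_w h (theta0, L w).
Proof.
move=> /cvg_in_distributionP UL ch hM.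
have chT th := @continuous_pair_section _ _ _ h th ch.
apply/cvgrPdist_le => e e0.
pose A := `|M|.
have hA z : `|h z| <= A by exact: le_trans (hM z) (ler_norm _).
have A0 : 0 <= A by exact: normr_ge0.
(* Multiplied by 2 A this stays below e / 2; the summand 4 keeps the denominator positive when A =
   0. *)
have e'0 : 0 < e / (4 * A + 4) by rewrite divr_gt0// ltr_wpDl// mulr_ge0.
have [K LK] := psi_tail e'0.
have UK : \forall i \near F, \int[P]_w psi K (U i w) < e / (4 * A + 4).
  by have /cvgr_lt := UL (psi K) 1 (@psi_continuous K) (@psi_norm K); exact.
have e40 : 0 < e / 4 by rewrite divr_gt0.
have /cvgrPdist_lt/(_ _ e40) U0 := UL _ _ (chT theta0) (fun v => hM (theta0, v)).
(* Joint continuity at each point of the compact set yields one neighbourhood of theta0 valid on all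
   of it. Each comparison passes through h (theta0, v) at the centre v, hence e / 8 twice. *)
have hB : \forall th \near theta0,
    [set v | rho v <= K + 1] `<=` [set v | `|h (th, v) - h (theta0, v)| <= e / 4].
  apply: ((compact_near_coveringP _).1 (@rho_compact (K + 1)) _ _
    (fun th v => `|h (th, v) - h (theta0, v)| <= e / 4)) => v _.
  have e8 : 0 < e / 8 by rewrite divr_gt0.
  have /cvgrPdist_lt/(_ _ e8) := ch (theta0, v).
  move=> [[B C] /= [B0 Cv] BC].
  exists (C, B) => //= -[v' th] /= [Cv' Bth].
  have h1 := BC (th, v') (conj Bth Cv').
  have h2 := BC (theta0, v') (conj (nbhs_singleton B0) Cv').
  apply: le_trans (ler_distD (h (theta0, v)) _ _) _.
  rewrite (distrC (h (th, v'))) /= in h1 h2 *.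
  apply: le_trans (lerD (ltW h1) (ltW h2)) _; lra.
(* Beyond the compact set the ramp equals 1 and pays for the crude bound 2 A. *)
have bound th : [set v | rho v <= K + 1] `<=` [set v | `|h (th, v) - h (theta0, v)| <= e / 4] ->
    forall v, `|h (th, v) - h (theta0, v)| <= e / 4 + 2 * A * psi K v.
  move=> hth v; have [vK|vK] := leP (rho v) (K + 1).
    by apply: le_trans (hth v vK) _; rewrite lerDl !mulr_ge0.
  have -> : psi K v = 1.
    rewrite /psi; have Kv : 1 <= rho v - K by lra.
    by rewrite (max_idPr _) ?(le_trans ler01 Kv)//; apply/min_idPl.
  apply: le_trans (ler_normB _ _) _.
  have := hA (th, v); have := hA (theta0, v); lra.
near=> p.
have U0p : `|\int[P']_w h (theta0, L w) - \int[P]_w h (theta0, U p.2 w)| < e / 4.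
  by near: p; exact: (@filter_prod2 _ _ (nbhs theta0) F _ _ U0).
have UKp : \int[P]_w psi K (U p.2 w) < e / (4 * A + 4).
  by near: p; exact: (cvg_snd UK).
have hp : [set v | rho v <= K + 1] `<=`
    [set v | `|h (p.1, v) - h (theta0, v)| <= e / 4].
  by near: p; exact: (@filter_prod1 _ _ (nbhs theta0) F _ _ hB).
have mh th : measurable_fun setT (fun w => h (th, U p.2 w)) by exact: (mU p.2 (chT th)).
have mpsi := mU p.2 (@psi_continuous K).
have Ipsi := integrable_of_bound P mpsi (fun w => psi_norm K (U p.2 w)).
have D : `|\int[P]_w h (p.1, U p.2 w) - \int[P]_w h (theta0, U p.2 w)| <=
    \int[P]_w (e / 4 + 2 * A * psi K (U p.2 w)).
  apply: (@Rintegral_dist _ _ _ _ _ _ _ (A + (e / 4 + 2 * A))) => //.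
  - by apply: measurable_funD => //; exact: measurable_funM.
  - by move=> w; apply: le_trans (hA _) _; lra.
  - by move=> w; apply: le_trans (hA _) _; lra.
  - move=> w; rewrite ger0_norm ?addr_ge0 ?mulr_ge0 ?divr_ge0 ?(ltW e0)//.
    have : 2 * A * psi K (U p.2 w) <= 2 * A * 1 by rewrite ler_wpM2l// mulr_ge0.
    lra.
  - by move=> w; exact: bound.
have E : \int[P]_w (e / 4 + 2 * A * psi K (U p.2 w)) =
    e / 4 + 2 * A * \int[P]_w psi K (U p.2 w).
  have Icst : P.-integrable setT (EFin \o (fun=> e / 4)).
    by apply: (@integrable_of_bound _ _ _ P _ (e / 4)) => // w; rewrite ger0_norm// ltW.
  have Ipsi2 : P.-integrable setT (EFin \o (fun w => 2 * A * psi K (U p.2 w))).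
    apply: (@integrable_of_bound _ _ _ P _ (2 * A)); first exact: measurable_funM.
    move=> w; rewrite ger0_norm ?mulr_ge0// -[leRHS]mulr1 ler_wpM2l ?mulr_ge0//.
  rewrite (RintegralD _ Icst Ipsi2)// (RintegralZl _ _ Ipsi)//.
  by rewrite Rintegral_probability_cst.
rewrite E in D.
have UKA : 2 * A * \int[P]_w psi K (U p.2 w) <= e / 2.
  apply: (@le_trans _ _ (2 * A * (e / (4 * A + 4)))).
    by rewrite ler_wpM2l ?mulr_ge0// ltW.
  by rewrite mulrA ler_pdivrMr; nra.
apply: le_trans (ler_distD (\int[P]_w h (theta0, U p.2 w)) _ _) _.
rewrite (distrC (\int[P]_w h (theta0, U p.2 w))).
lra.
Unshelve. all: by end_near. Qed.

End ConvergenceInDistribution.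

(** The previous lemma applied to a constant sequence of variables, which converges in distribution
    to itself. *)
Lemma continuous_Rintegral_param (R : realType) d (T : measurableType d)
    (P : probability T R) (V Theta : topologicalType) (L : T -> V) (rho : V -> R)
    (h : Theta * V -> R) (M : R) :
  (forall f : V -> R, continuous f -> measurable_fun setT (f \o L)) ->
  continuous rho -> (forall K, compact [set v | rho v <= K]) ->
  continuous h -> (forall z, `|h z| <= M) ->
  continuous (fun theta => \int[P]_w h (theta, L w)).
Proof.
move=> mL crho Krho ch hM theta.
have LL : cvg_in_distribution P P (fun (_ : nat) w => L w) \oo L.
  by move=> f _ _; exact: cvg_cst.
have hcvg : \int[P]_w h (p.1, L w) @[p --> filter_prod (nbhs theta) \oo]
    --> \int[P]_w h (theta, L w).
  exact: (@cvg_in_distribution_param _ _ _ _ _ P P V nat \oo _ (fun=> L) L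
    (fun=> mL) mL rho crho Krho Theta h M theta LL ch hM).
move/cvgrPdist_le in hcvg; apply/cvgrPdist_le => e e0.
have [[B C] /= [thetaB ooC] BC] := hcvg e e0.
have [n Cn] := filter_ex ooC.
by apply: filterS thetaB => th Bth; exact: (BC (th, n)).
Qed.

(** * Elementary properties of joint distribution functions *)

Section DistributionFunctions.
Context (R : realType) d (T : measurableType d) (P : probability T R).
Variables X Y : T -> R.
Hypothesis mX : measurable_fun setT X.
Hypothesis mY : measurable_fun setT Y.

Let mXY x y : measurable [set w | X w <= x /\ Y w <= y].
Proof.
have mle (Z : T -> R) z : measurable_fun setT Z -> measurable [set w | Z w <= z].
  move=> mZ; rewrite (_ : mkset _ = Z @^-1` `]-oo, z]).
    by rewrite -[X in measurable X]setTI; exact: mZ.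
  by apply/seteqP; split => w /=; rewrite in_itv.
rewrite (_ : mkset _ = [set w | X w <= x] `&` [set w | Y w <= y])//.
by apply: measurableI; exact: mle.
Qed.

Lemma joint_cdf_itv x y : 0 <= joint_cdf P X Y x y <= 1.
Proof.
rewrite /joint_cdf; have PA := probability_le1 P (mXY x y).
rewrite fine_ge0//= -lee_fin fineK// ge0_fin_numE//.
by rewrite (le_lt_trans PA)// ltry.
Qed.

Lemma joint_cdf_homo x x' y y' : x <= x' -> y <= y' ->
  joint_cdf P X Y x y <= joint_cdf P X Y x' y'.
Proof.
move=> xx' yy'; apply: fine_le; rewrite ?fin_num_measure//.
apply: le_measure; rewrite ?inE//.
by move=> w [Xx Yy]; split; [exact: le_trans Xx _|exact: le_trans Yy _].
Qed.

End DistributionFunctions.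

(** * From uniform bivariate convergence to the marginals *)

Section MarginalConvergence.
Context (R : realType).

(** A supremum in R dominates its set only when that set is bounded; the bound [B] guarantees this
    for positive times. *)
Lemma cvg_le_sup_range (K : R -> R * R -> R) (B : R) :
  (forall t z, 0 < t -> `|K t z| <= B) ->
  sup (range (fun z => `|K t z|)) @[t --> +oo] --> 0 ->
  exists2 S : R -> R, S t @[t --> +oo] --> 0 &
    forall t x y, 0 < t -> `|K t (x, y)| <= S t.
Proof.
move=> KB K0; exists (fun t => sup (range (fun z => `|K t z|))) => // t x y t0.
apply: sup_upper_bound; last by exists (x, y).
split; first by exists `|K t (x, y)|; exists (x, y).
by exists B => _ [z _ <-]; exact: KB.
Qed.

(** At fixed t the error bound [S t] is uniform in y, so it survives y -> oo; positivity of a' sends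
    the normalised second argument to infinity as well. *)
Lemma marginal_cvg (F H : R -> R -> R) (F1 H1 a b a' b' S : R -> R) :
  (forall x y, 0 <= F x y <= 1) ->
  (forall x, F x y @[y --> +oo] --> F1 x) ->
  (forall x, H x y @[y --> +oo] --> H1 x) ->
  (forall t, 0 < t -> 0 < a' t) ->
  (forall t x y, 0 < t ->
    `|F (a t * x + b t) (a' t * y + b' t) `^ t - H x y| <= S t) ->
  S t @[t --> +oo] --> 0 ->
  forall x, F1 (a t * x + b t) `^ t @[t --> +oo] --> H1 x.
Proof.
move=> F01 FF1 HH1 a'0 FHS S0 x.
have F10 z : 0 <= F1 z.
  by apply: cvgr_to_ge (FF1 z) _; apply: nearW => y; have /andP[] := F01 z y.
have bound t : 0 < t -> `|F1 (a t * x + b t) `^ t - H1 x| <= S t.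
  move=> t0; have ay : a' t * y + b' t @[y --> +oo] --> +oo.
    apply/cvgryPge => A; near=> y.
    rewrite -lerBlDr mulrC -ler_pdivrMr ?a'0//; near: y.
  have Fcvg : F (a t * x + b t) (a' t * y + b' t) `^ t - H x y @[y --> +oo] -->
      F1 (a t * x + b t) `^ t - H1 x.
    apply: cvgB => //; apply: cvg_powR => //; last exact: cvg_cst.
      by apply: nearW => y; exact: F01.
    exact: (cvg_comp _ _ ay (@FF1 (a t * x + b t))).
  apply: cvgr_to_le (cvg_norm Fcvg) _.
  by apply: nearW => y; exact: FHS.
apply/cvgrPdist_le => e e0; near=> t.
have t0 : 0 < t by near: t; apply: nbhs_pinfty_gt; exact: num_real.
rewrite distrC; apply: le_trans (bound t t0) _.
apply: le_trans (ler_norm _) _; near: t.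
by move/cvgr0Pnorm_le : S0; exact.
Unshelve. all: by end_near. Qed.

Lemma marginal_ge0_le1_homo (F : R -> R -> R) (F1 : R -> R) :
  (forall x y, 0 <= F x y <= 1) ->
  (forall x x' y, x <= x' -> F x y <= F x' y) ->
  (forall x, F x y @[y --> +oo] --> F1 x) ->
  [/\ forall x, 0 <= F1 x, forall x, F1 x <= 1 & {homo F1 : x y / x <= y}].
Proof.
move=> F01 Fle FF1; split=> [x|x|x y xy].
- by apply: cvgr_to_ge (FF1 x) _; apply: nearW => y; have /andP[] := F01 x y.
- by apply: cvgr_to_le (FF1 x) _; apply: nearW => y; have /andP[] := F01 x y.
- by apply: ler_cvg_to (FF1 x) (FF1 y) _; apply: nearW => z; exact: Fle.
Qed.

End MarginalConvergence.

(** * A cutoff away from 0 and infinity *)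

Section Cutoff.
Context (R : realType).

(** A piecewise linear bump: 0 outside (1 / (k+1), k+1), and 1 where 2 / (k+1) <= z <= k. *)
Definition cutoff (k : nat) (z : R) : R :=
  Num.max 0 (Num.min 1 (Num.min (k.+1%:R * z - 1) (k.+1%:R - z))).

Lemma cutoff_ge0 k z : 0 <= cutoff k z.
Proof. by rewrite le_max lexx. Qed.

Lemma cutoff_le1 k z : cutoff k z <= 1.
Proof. by rewrite ge_max ler01 ge_min lexx. Qed.

Lemma cutoff_norm k z : `|cutoff k z| <= 1.
Proof. by rewrite ger0_norm ?cutoff_ge0 ?cutoff_le1. Qed.

Lemma cutoff_continuous k : continuous (cutoff k).
Proof.
have clin : continuous (fun z : R => k.+1%:R * z - 1).
  move=> z; apply: cvgB; last exact: cvg_cst.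
  by apply: cvgM; [exact: cvg_cst|exact: cvg_id].
have csub : continuous (fun z : R => k.+1%:R - z).
  by move=> z; apply: cvgB; [exact: cvg_cst|exact: cvg_id].
have cmin z := continuous_min (clin z) (csub z).
have cmin1 z := continuous_min (@cst_continuous R R 1 z) (cmin z).
by move=> z; exact: (continuous_max (@cst_continuous R R 0 z) (cmin1 z)).
Qed.

Lemma cutoff_eq0 k z : z <= k.+1%:R^-1 -> cutoff k z = 0.
Proof.
move=> zk; apply/max_idPl; rewrite ge_min ge_min; apply/orP; right.
apply/orP; left; rewrite subr_le0.
by rewrite -ler_pdivlMl// mulr1.
Qed.

Lemma cutoff_neq0 k z : cutoff k z != 0 -> z \in `[k.+1%:R^-1, k.+1%:R].
Proof.
move=> kz; rewrite in_itv/=; apply/andP; split.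
  by have [//|/ltW /cutoff_eq0 kz0] := leP k.+1%:R^-1 z; rewrite kz0 eqxx in kz.
have [//|zk] := leP z k.+1%:R; case/negP: kz; apply/eqP/max_idPl.
by rewrite !ge_min !subr_le0 (ltW zk) !orbT.
Qed.

Lemma cvg_cutoff (z : R) : 0 < z -> cutoff k z @[k --> \oo] --> (1 : R).
Proof.
move=> z0; have largeS (c : R) : \forall k \near \oo, c <= k.+1%:R.
  by apply: filterS (nbhs_infty_ger c) => k ck; rewrite (le_trans ck)// ler_nat.
apply: cvg_near_cst; near=> k.
have k1 : 2 / z <= k.+1%:R by near: k; exact: largeS.
have k2 : 1 + z <= k.+1%:R by near: k; exact: largeS.
rewrite /cutoff [Num.min 1 _]min_l; first by apply/max_idPr; exact: ler01.
rewrite le_min; apply/andP; split; last by rewrite lerBrDr.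
by move: k1; rewrite ler_pdivrMr//; lra.
Unshelve. all: by end_near. Qed.

End Cutoff.

(** * Replacing a deterministic index by a random one *)

Section RandomIndex.
Context (R : realType) d d' (T : measurableType d) (T' : measurableType d').
Context (P : probability T R) (P' : probability T' R).
Variables (N : R -> T -> nat) (Z : T' -> R).
Hypothesis mN : forall t, measurable_fun setT (N t).
Hypothesis mZ : measurable_fun setT Z.
Hypothesis Z_pos : {ae P', forall w, 0 < Z w}.
Hypothesis Z_cvg : cvg_in_distribution P P' (fun t w => (N t w)%:R / t) +oo Z.

(** With phi a cutoff, u(t, N(t)) is close to (phi g)(N(t) / t), and phi g is bounded and continuous
    on all of R although g is only continuous on (0, oo). Weak convergence of N(t) / t then applies
    to phi g. *)
Lemma cvg_random_index (u : R -> nat -> R) (g : R -> R) (A : R) :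
  (forall t n, `|u t n| <= A) -> (forall s, `|g s| <= A) ->
  measurable_fun setT g -> (forall s : R, 0 < s -> {for s, continuous g}) ->
  (forall s e : R, 0 < s -> 0 < e -> \forall s' \near s & t \near +oo,
    forall n, n%:R = t * s' -> `|u t n - g s'| <= e) ->
  \int[P]_w u t (N t w) @[t --> +oo] --> \int[P']_w g (Z w).
Proof.
move=> uA gA mg cg ug.
have A0 : 0 <= A by exact: le_trans (normr_ge0 _) (gA 0).
have mNt t (f : R -> R) : continuous f -> measurable_fun setT (f \o (fun w => (N t w)%:R / t : R)).
  move=> cf; apply: measurableT_comp; first exact: continuous_measurable_fun.
  by apply: (measurableT_comp (f := fun n : nat => n%:R / t)).
have mZf (f : R -> R) : continuous f -> measurable_fun setT (f \o Z).
  by move=> cf; apply: measurableT_comp; first exact: continuous_measurable_fun.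
have Zcvg (f : R -> R) M : continuous f -> (forall z, `|f z| <= M) ->
    \int[P]_w f ((N t w)%:R / t) @[t --> +oo] --> \int[P']_w f (Z w).
  exact: ((@cvg_in_distributionP _ _ _ _ _ P P' R R (pinfty_nbhs R) _
    (fun t w => (N t w)%:R / t) Z mNt mZf).1 Z_cvg).
apply/cvgrPdist_le => e e0.
have e'0 : 0 < e / (4 * A + 4) by rewrite divr_gt0// ltr_wpDl// mulr_ge0.
(* Almost sure positivity of Z enters here: the cutoffs tend to 1 at positive points. A times the
   lost mass is at most e / 4. *)
have [k Zk] : exists k, 1 - e / (4 * A + 4) < \int[P']_w cutoff k (Z w).
  have : \int[P']_w cutoff k (Z w) @[k --> \oo] --> (1 : R).
    have [] := @dominated_convergence _ _ _ P' setT measurableT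
      (fun k w => (cutoff k (Z w))%:E) (cst 1%E) (cst 1%E).
    - by move=> k; apply/measurable_EFinP; exact: (mZf _ (@cutoff_continuous R k)).
    - exact: measurable_cst.
    - apply: filterS Z_pos => w Zw _.
      by apply: cvg_EFin; [exact: nearW|exact: cvg_cutoff].
    - by apply: (@integrable_of_bound _ _ _ P' (cst 1) 1) => // w; rewrite normr1.
    - by apply: aeW => w k _; rewrite lee_fin cutoff_norm.
    have -> : (\int[P']_w cst 1 w = 1%:E)%E.
      by rewrite integral_cst// mul1e; exact: probability_setT.
    move=> _ _.
    by move/fine_cvgP => [_].
  move=> /cvgr_gt/(_ (1 - e / (4 * A + 4))) [|k _ /(_ k (leqnn k))]; last by exists k.
  by rewrite ltrBlDr ltrDl.
pose phi := cutoff k : R -> R.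
have phi0 z : 0 <= phi z by exact: cutoff_ge0.
have phi1 z : phi z <= 1 by exact: cutoff_le1.
have phiN z : `|phi z| <= 1 by exact: cutoff_norm.
have cphi : continuous phi by exact: cutoff_continuous.
have cphig : continuous (fun z : R => phi z * g z).
  move=> z; have [z0|z0] := leP z 0; last by apply: cvgM; [exact: cphi|exact: cg].
  suff: phi y * g y @[y --> z] --> phi z * g z by [].
  have -> : phi z * g z = 0.
    by rewrite /phi cutoff_eq0 ?mul0r// (le_trans z0)// invr_ge0.
  apply: cvg_near_cst; near=> y; rewrite /phi cutoff_eq0 ?mul0r// ltW//.
  near: y; apply: lt_nbhsl; by rewrite (le_lt_trans z0)// invr_gt0.
have phigA z : `|phi z * g z| <= A.
  by rewrite normrM -[leRHS]mul1r ler_pM.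
(* Compactness of the interval turns the local estimates in s into a single threshold for t. *)
have ug_near : \forall t \near +oo, `[k.+1%:R^-1, k.+1%:R]%classic `<=`
    [set s | forall n, n%:R = t * s -> `|u t n - g s| <= e / 4].
  have Kc := @segment_compact R k.+1%:R^-1 k.+1%:R.
  apply: ((compact_near_coveringP _).1 Kc _ _
    (fun t s => forall n, n%:R = t * s -> `|u t n - g s| <= e / 4)) => s.
  rewrite /= in_itv/= => /andP[ks _]; apply: ug; last by rewrite divr_gt0.
  by rewrite (lt_le_trans _ ks)// invr_gt0.
have e40 : 0 < e / 4 by rewrite divr_gt0.
have Zphi : \forall t \near +oo,
    1 - e / (4 * A + 4) < \int[P]_w phi ((N t w)%:R / t).
  by have /cvgr_gt := Zcvg _ _ cphi phiN; exact.
have Zphig : \forall t \near +oo, `|\int[P']_w (phi (Z w) * g (Z w)) -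
    \int[P]_w (phi ((N t w)%:R / t) * g ((N t w)%:R / t))| <= e / 4.
  by have /cvgrPdist_le := Zcvg _ _ cphig phigA; exact.
(* One estimate for both spaces: an error r wherever the cutoff is 1, and at most A times the mass
   lost by the cutoff. *)
have tail d0 (S : measurableType d0) (Q : probability S R) (f h psi : S -> R) r :
    measurable_fun setT f -> measurable_fun setT h -> measurable_fun setT psi ->
    (forall w, `|f w| <= A) -> (forall w, `|h w| <= A) -> (forall w, 0 <= psi w <= 1) ->
    0 <= r -> 1 - e / (4 * A + 4) < \int[Q]_w psi w ->
    (forall w, `|f w - h w| <= r + A * (1 - psi w)) ->
    `|\int[Q]_w f w - \int[Q]_w h w| <= r + e / 4.
  move=> mf mh mpsi fA hA psi01 r0 Qpsi fh.
  have mB : measurable_fun setT (fun w => r + A * (1 - psi w)).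
    by apply: measurable_funD => //; apply: measurable_funM => //; exact: measurable_funB.
  apply: (@le_trans _ _ (\int[Q]_w (r + A * (1 - psi w)))).
    apply: (@Rintegral_dist _ _ _ _ _ _ _ (r + A)) => // w.
    - by rewrite (le_trans (fA w))// lerDr.
    - by rewrite (le_trans (hA w))// lerDr.
    - have /andP[p0 p1] := psi01 w.
      rewrite ger0_norm ?addr_ge0 ?mulr_ge0 ?subr_ge0// lerD2l.
      by rewrite -[leRHS]mulr1 ler_wpM2l// gerBl.
  have Ipsi : Q.-integrable setT (EFin \o psi).
    apply: (@integrable_of_bound _ _ _ Q _ 1) => // w.
    by have /andP[p0 p1] := psi01 w; rewrite ger0_norm.
  have Ic c : Q.-integrable setT (EFin \o (fun=> c)).
    by apply: (@integrable_of_bound _ _ _ Q _ `|c|).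
  have Ipsi1 : Q.-integrable setT (EFin \o (fun w => 1 - psi w)).
    apply: (@integrable_of_bound _ _ _ Q _ 1); first exact: measurable_funB.
    by move=> w; have /andP[p0 p1] := psi01 w; rewrite ger0_norm ?subr_ge0// gerBl.
  have Ipsi2 : Q.-integrable setT (EFin \o (fun w => A * (1 - psi w))).
    apply: (@integrable_of_bound _ _ _ Q _ A).
      by apply: measurable_funM => //; exact: measurable_funB.
    move=> w; have /andP[p0 p1] := psi01 w.
    by rewrite ger0_norm ?mulr_ge0 ?subr_ge0// -[leRHS]mulr1 ler_wpM2l// gerBl.
  rewrite (RintegralD _ (Ic r) Ipsi2)// (RintegralZl _ _ Ipsi1)// (RintegralB _ (Ic 1) Ipsi)//.
  rewrite !Rintegral_probability_cst lerD2l.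
  apply: (@le_trans _ _ (A * (e / (4 * A + 4)))).
    by rewrite ler_wpM2l//; lra.
  by rewrite mulrA ler_pdivrMr; nra.
have limit : `|\int[P']_w g (Z w) - \int[P']_w (phi (Z w) * g (Z w))| <= 0 + e / 4.
  apply: (tail _ _ _ _ _ (phi \o Z)) => //.
  - exact: measurableT_comp.
  - exact: (mZf _ cphig).
  - exact: (mZf _ cphi).
  - by move=> w; rewrite phi0 phi1.
  - move=> w; rewrite add0r -[X in X - _]mul1r -mulrBl normrM mulrC.
    by rewrite (ger0_norm (_ : 0 <= 1 - _)) ?subr_ge0// ler_wpM2r ?subr_ge0.
near=> t.
have t0 : 0 < t by near: t; apply: nbhs_pinfty_gt; exact: num_real.
have ugt : `[k.+1%:R^-1, k.+1%:R]%classic `<=`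
    [set s | forall n, n%:R = t * s -> `|u t n - g s| <= e / 4] by near: t.
have main : `|\int[P]_w u t (N t w) -
    \int[P]_w (phi ((N t w)%:R / t) * g ((N t w)%:R / t))| <= e / 4 + e / 4.
  apply: (tail _ _ _ _ _ (fun w => phi ((N t w)%:R / t))) => //.
  - exact: (measurableT_comp (f := u t)).
  - exact: (mNt _ _ cphig).
  - exact: (mNt _ _ cphi).
  - by move=> w; rewrite phi0 phi1.
  - exact: ltW.
  - by near: t.
  - move=> w; set s := _ / t.
    (* Where the cutoff vanishes only |u| <= A is available; elsewhere s lies in the compact
       interval and the uniform estimate applies. *)
    have [->|phis] := eqVneq (phi s) 0.
      by rewrite mul0r !subr0 mulr1 (le_trans (uA _ _))// lerDr ltW.
    have us : `|u t (N t w) - g s| <= e / 4.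
      by apply: ugt; [exact: cutoff_neq0|rewrite /s mulrC divfK ?gt_eqF].
    rewrite (_ : u t _ - _ = (u t (N t w) - g s) + (1 - phi s) * g s); last by ring.
    apply: le_trans (ler_normD _ _) _; rewrite lerD// normrM mulrC.
    by rewrite (ger0_norm (_ : 0 <= 1 - _)) ?subr_ge0// ler_wpM2r ?subr_ge0.
have Zt : `|\int[P']_w (phi (Z w) * g (Z w)) -
    \int[P]_w (phi ((N t w)%:R / t) * g ((N t w)%:R / t))| <= e / 4 by near: t.
move: main limit Zt; rewrite !ler_norml => /andP[? ?] /andP[? ?] /andP[? ?].
by apply/andP; split; lra.
Unshelve. all: by end_near. Qed.

End RandomIndex.

(** * Affine changes of normalisation *)

Section AffineMatrix.
Context (R : realType) (m : nat).

Local Notation param := ((R * R) * (R * R))%type.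

(** The parameter holds (scale, shift) for the first column and then for the second; as one point of
    a topological space it can be the varying parameter of [cvg_in_distribution_param]. *)
Definition affine_mx (th : param) (v : 'M[R]_(m, 2)) : 'M[R]_(m, 2) :=
  \matrix_(j, k) if k == ord0 then th.1.1 * v j k + th.1.2
                 else th.2.1 * v j k + th.2.2.

Lemma affine_mx_continuous :
  continuous (fun z : param * 'M[R]_(m, 2) => affine_mx z.1 z.2).
Proof.
move=> z; apply: (@cvg_mx _ _ R _ (nbhs z)) => j k; rewrite mxE.
under eq_fun do rewrite mxE.
have cv : (y.2 : 'M[R]_(m, 2)) j k @[y --> z] --> z.2 j k.
  by apply: (@continuous_comp _ _ _ snd (fun v : 'M[R]_(m, 2) => v j k));
    [exact: cvg_snd|exact: coord_continuous].
have c1 : (y.1 : param) @[y --> z] --> z.1 by exact: cvg_fst.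
have c11 : y.1.1 @[y --> z] --> z.1.1 by apply: (cvg_comp _ _ c1); exact: cvg_fst.
have c12 : y.1.2 @[y --> z] --> z.1.2 by apply: (cvg_comp _ _ c1); exact: cvg_snd.
case: ifP => _; apply: cvgD.
- apply: cvgM => //; apply: (cvg_comp _ _ c11); exact: cvg_fst.
- by apply: (cvg_comp _ _ c11); exact: cvg_snd.
- apply: cvgM => //; apply: (cvg_comp _ _ c12); exact: cvg_fst.
- by apply: (cvg_comp _ _ c12); exact: cvg_snd.
Qed.

Lemma upper_order_stats_affine (x y : nat -> R) n (a1 b1 a2 b2 A1 B1 A2 B2 : R) :
  a1 != 0 -> a2 != 0 -> A1 != 0 -> A2 != 0 ->
  upper_order_stats m x y n A1 B1 A2 B2 =
  affine_mx ((a1 / A1, (b1 - B1) / A1), (a2 / A2, (b2 - B2) / A2))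
    (upper_order_stats m x y n a1 b1 a2 b2).
Proof.
move=> a10 a20 A10 A20; apply/matrixP => j k; rewrite !mxE /=.
by case: ifP => _; field; apply/andP.
Qed.

Lemma pairs_mx_affine (th : param) (x y : 'I_m -> R) :
  pairs_mx (fun j => th.1.1 * x j + th.1.2) (fun j => th.2.1 * y j + th.2.2) =
  affine_mx th (pairs_mx x y).
Proof. by apply/matrixP => j k; rewrite !mxE; case: ifP. Qed.

Context d (T : measurableType d).

Lemma measurable_pairs_mx (x y : 'I_m -> T -> R) (f : 'M[R]_(m, 2) -> R) :
  (forall j, measurable_fun setT (x j)) -> (forall j, measurable_fun setT (y j)) ->
  continuous f ->
  measurable_fun setT (fun w => f (pairs_mx (x ^~ w) (y ^~ w))).
Proof.
move=> mx my.
apply: (@measurable_fun_mx _ _ _ _ _ (fun w => pairs_mx (x ^~ w) (y ^~ w))) => j k.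
rewrite (_ : (fun _ => _) = if k == ord0 then x j else y j); first by case: (k == ord0).
by apply/funext => w; rewrite mxE; case: (k == ord0).
Qed.

(** The sample size has countably many values, which reduces each entry to fixed sizes. [N] may be a
    constant or a coordinate of a product space. *)
Lemma measurable_upper_order_stats (X Y : nat -> T -> R) (N : T -> nat)
    (a1 b1 a2 b2 : R) (f : 'M[R]_(m, 2) -> R) :
  (forall n, measurable_fun setT (X n)) -> (forall n, measurable_fun setT (Y n)) ->
  measurable_fun setT N -> continuous f ->
  measurable_fun setT (fun w =>
    f (upper_order_stats m (X ^~ w) (Y ^~ w) (N w) a1 b1 a2 b2)).
Proof.
move=> mX mY mN cf.
have mO (W : nat -> T -> R) a b (j : 'I_m) : (forall n, measurable_fun setT (W n)) ->
    measurable_fun setT (fun w =>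
      (order_stat (W ^~ w) (N w - j.+1).+1 (N w) - b) / a).
  move=> mW; apply: (@measurable_fun_countable _ _ _ _ _ N
    (fun n w => (order_stat (W ^~ w) (n - j.+1).+1 n - b) / a)) => n.
    by rewrite -[X in measurable X]setTI; exact: mN.
  apply: measurable_funM => //; apply: measurable_funB => //.
  exact: measurable_order_stat.
apply: (@measurable_pairs_mx
  (fun j w => (order_stat (X ^~ w) (N w - j.+1).+1 (N w) - b1) / a1)
  (fun j w => (order_stat (Y ^~ w) (N w - j.+1).+1 (N w) - b2) / a2)) => // j;
  exact: mO.
Qed.

End AffineMatrix.

(** * Regularity of the limiting coefficients, and convergence of both marginals *)

Lemma cvg_pair_nbhs {U V : topologicalType} {I : Type} {F : set_system I}
    {FF : Filter F} (f : I -> U) (g : I -> V) (x : U) (y : V) :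
  f i @[i --> F] --> x -> g i @[i --> F] --> y -> (f i, g i) @[i --> F] --> (x, y).
Proof. by move=> fx gy; exact: cvg_pair. Qed.

Section RescalingParameters.
Context (R : realType).
Implicit Type h : extreme_value_law R.

Lemma powR_continuous_at (p s : R) : 0 < s -> {for s, continuous (@powR R ^~ p)}.
Proof.
move=> s0; apply: differentiable_continuous; apply/derivable1_diffP.
by apply: derivable_powR; rewrite in_itv/= s0.
Qed.

Lemma ev_delta_continuous_at h (s : R) : 0 < s -> {for s, continuous (ev_delta h)}.
Proof.
by move=> s0; case: h => [a|a|]; [exact: cvg_cst|exact: cvg_cst|exact: continuous_ln].
Qed.

Lemma measurable_ev_delta h : measurable_fun setT (ev_delta h).
Proof.
by case: h => [a|a|];
  [exact: measurable_cst|exact: measurable_cst|exact: measurable_ln].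
Qed.

Lemma joint_cvg_marginals (F H : R -> R -> R) (F1 F2 H1 H2 : R -> R)
    (a1 b1 a2 b2 : R -> R) :
  (forall x y, 0 <= F x y <= 1) -> (forall x y, 0 <= H x y <= 1) ->
  (forall t, 0 < t -> 0 < a1 t) -> (forall t, 0 < t -> 0 < a2 t) ->
  marginals F F1 F2 -> marginals H H1 H2 ->
  sup (range (fun z : R * R =>
      `|F (a1 t * z.1 + b1 t) (a2 t * z.2 + b2 t) `^ t - H z.1 z.2|))
    @[t --> +oo] --> 0 ->
  (forall x, F1 (a1 t * x + b1 t) `^ t @[t --> +oo] --> H1 x) /\
  (forall y, F2 (a2 t * y + b2 t) `^ t @[t --> +oo] --> H2 y).
Proof.
move=> F01 H01 a10 a20 [FF1 FF2] [HH1 HH2] FH.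
have [|S S0 FHS] := cvg_le_sup_range (B := 1) _ FH.
  move=> t z t0; have /andP[F0 F1'] := F01 (a1 t * z.1 + b1 t) (a2 t * z.2 + b2 t).
  have /andP[H0 H1'] := H01 z.1 z.2.
  set v := F _ _ in F0 F1' *.
  have v0 : 0 <= v `^ t by exact: powR_ge0.
  have v1 : v `^ t <= 1.
    apply: (@le_trans _ _ (1 `^ t)); last by rewrite powR1.
    by apply: ge0_ler_powR; rewrite ?nnegrE// ltW.
  by rewrite ler_norml; lra.
split.
- by apply: (marginal_cvg F01 FF1 HH1 a20 _ S0) => t x y; exact: FHS.
(* The second marginal follows by exchanging the coordinates. *)
- apply: (@marginal_cvg _ (fun y x => F x y) (fun y x => H x y) F2 H2 a2 b2 a1 b1 S) => //.
  by move=> t y x; exact: FHS.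
Qed.

End RescalingParameters.

(** * Convergence of the randomly indexed upper order statistics *)

Theorem proposition2p1 (R : realType)
  (d : measure_display) (T : measurableType d) (P : probability T R)
  (X Y : nat -> {RV P >-> R}) (N : R -> {RV P >-> nat})
  (F : R -> R -> R) (F1 F2 : R -> R)
  (F_common : forall n x y, joint_cdf P (X n) (Y n) x y = F x y)
  (F_marginals : marginals F F1 F2)
  (N_indep : independent_processes P [set t : R | 0 <= t] (fun t => N t : T -> nat)
     [set: nat] (fun n w => (X n w, Y n w)))
  (d' : measure_display) (T' : measurableType d') (P' : probability T' R)
  (Z : {RV P' >-> R}) (m : nat) (XX YY : 'I_m -> {RV P' >-> R})
  (Z_cvg : cvg_in_distribution P P' (fun t w => (N t w)%:R / t) +oo Z)
  (Z_pos : {ae P', forall w, 0 < Z w})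
  (a1 b1 a2 b2 : R -> R)
  (a1_pos : forall t, 0 < t -> 0 < a1 t) (a2_pos : forall t, 0 < t -> 0 < a2 t)
  (H : R -> R -> R) (h1 h2 : extreme_value_law R)
  (H_df : bivariate_df H) (H_max_stable : max_stable H)
  (H_marginals : marginals H (ev_df h1) (ev_df h2))
  (F_cvg : sup (range (fun z : R * R =>
      `|F (a1 t * z.1 + b1 t) (a2 t * z.2 + b2 t) `^ t - H z.1 z.2|))
    @[t --> +oo] --> 0)
  (m_gt0 : (0 < m)%N)
  (stat_cvg : cvg_in_distribution P P'
     (fun n w => upper_order_stats m (X ^~ w) (Y ^~ w) n
        (a1 n%:R) (b1 n%:R) (a2 n%:R) (b2 n%:R)) \oo
     (fun w => pairs_mx (fun j => XX j w) (fun j => YY j w)))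
  (Z_indep : independent_processes P' [set: unit] (fun=> Z : T' -> R)
     [set: 'I_m] (fun j w => (XX j w, YY j w))) :
  cvg_in_distribution P P'
    (fun t w => upper_order_stats m (X ^~ w) (Y ^~ w) (N t w)
       (a1 t) (b1 t) (a2 t) (b2 t)) +oo
    (fun w => pairs_mx
       (fun j => Z w `^ ev_gamma h1 * XX j w + ev_delta h1 (Z w))
       (fun j => Z w `^ ev_gamma h2 * YY j w + ev_delta h2 (Z w))).
Proof.
have F01 x y : 0 <= F x y <= 1.
  by rewrite -(F_common 0%N); exact: joint_cdf_itv.
have Fle x x' y y' : x <= x' -> y <= y' -> F x y <= F x' y'.
  by rewrite -!(F_common 0%N); exact: joint_cdf_homo.
have H01 x y : 0 <= H x y <= 1.
  have [mu ->] := H_df.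
  by apply: joint_cdf_itv; [exact: measurable_fst|exact: measurable_snd].
have [F1cvg F2cvg] := joint_cvg_marginals F01 H01 a1_pos a2_pos F_marginals H_marginals F_cvg.
have [F1_ge0 F1_le1 F1_homo] := marginal_ge0_le1_homo F01
  (fun x x' y xx' => Fle x x' y y xx' (lexx y)) F_marginals.1.
have [F2_ge0 F2_le1 F2_homo] := @marginal_ge0_le1_homo _ (fun y x => F x y) F2
  (fun y x => F01 x y) (fun y y' x yy' => Fle x x y y' (lexx x) yy') F_marginals.2.
have types1 := cvg_scale_location F1_ge0 F1_le1 F1_homo a1_pos F1cvg.
have types2 := cvg_scale_location F2_ge0 F2_le1 F2_homo a2_pos F2cvg.
(* The limit of the coefficients that change the normalisation from time t s to time t. *)
pose theta (s : R) := ((s `^ ev_gamma h1, ev_delta h1 s), (s `^ ev_gamma h2, ev_delta h2 s)).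
pose L w := pairs_mx (fun j => XX j w) (fun j => YY j w).
pose U t n w := upper_order_stats m (X ^~ w) (Y ^~ w) n (a1 t) (b1 t) (a2 t) (b2 t).
have mL (f : 'M[R]_(m, 2) -> R) : continuous f -> measurable_fun setT (f \o L).
  by move=> cf; apply: measurable_pairs_mx => // j; exact: measurable_funP.
have mU t n (f : 'M[R]_(m, 2) -> R) : continuous f -> measurable_fun setT (f \o U t n).
  move=> cf; apply: (@measurable_upper_order_stats _ _ _ _ X Y (cst n)) => // k;
  exact: measurable_funP.
have mZ : measurable_fun setT (Z : T' -> R) by exact: measurable_funP.
have mN t : measurable_fun setT (N t : T -> nat) by exact: measurable_funP.
have limE w : pairs_mx (fun j => Z w `^ ev_gamma h1 * XX j w + ev_delta h1 (Z w))
    (fun j => Z w `^ ev_gamma h2 * YY j w + ev_delta h2 (Z w)) =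
    affine_mx (theta (Z w)) (L w).
  by rewrite -pairs_mx_affine.
under [X in cvg_in_distribution _ _ _ _ X]eq_fun do rewrite limE.
(* Stated over an arbitrary space, to serve both on [T'] and on the product with the generated
   sigma-algebra required by Fubini. *)
have jm d0 (S : measurableType d0) (z : S -> R) (x y : 'I_m -> S -> R) (f : 'M[R]_(m, 2) -> R) :
    measurable_fun setT z -> (forall j, measurable_fun setT (x j)) ->
    (forall j, measurable_fun setT (y j)) -> continuous f ->
    measurable_fun setT (fun w => f (affine_mx (theta (z w)) (pairs_mx (x ^~ w) (y ^~ w)))).
  move=> mz mx my cf; under eq_fun do rewrite -pairs_mx_affine.
  have mzp p : measurable_fun setT (fun w => z w `^ p).
    by apply: (measurableT_comp (measurable_powR p)).
  have mzd h : measurable_fun setT (fun w => ev_delta h (z w)).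
    by apply: (measurableT_comp (measurable_ev_delta h)).
  by apply: (@measurable_pairs_mx _ _ _ _
    (fun j w => z w `^ ev_gamma h1 * x j w + ev_delta h1 (z w))
    (fun j w => z w `^ ev_gamma h2 * y j w + ev_delta h2 (z w))) => // j;
    apply: measurable_funD => //; apply: measurable_funM.
apply/cvg_in_distributionP.
- move=> t f cf; apply: (@measurable_upper_order_stats _ _ _ _ X Y (N t)) => // k;
  exact: measurable_funP.
- by move=> f cf; exact: (jm _ _ Z (fun j => XX j) (fun j => YY j)).
move=> f M cf fM.
pose h (z : ((R * R) * (R * R)) * 'M[R]_(m, 2)) := f (affine_mx z.1 z.2).
have ch : continuous h.
  by move=> z; apply: continuous_comp; [exact: affine_mx_continuous|exact: cf].
have hM z : `|h z| <= M by exact: fM.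
pose g s := \int[P']_w h (theta s, L w).
pose u t n := \int[P]_w f (U t n w).
have theta_cvg (s : R) : 0 < s -> theta y @[y --> s] --> theta s.
  move=> s0.
  by apply: cvg_pair_nbhs; apply: cvg_pair_nbhs;
    [exact: powR_continuous_at|exact: ev_delta_continuous_at
    |exact: powR_continuous_at|exact: ev_delta_continuous_at].
have [mg gE] : measurable_fun setT g /\
    \int[P']_w h (theta (Z w), L w) = \int[P']_w g (Z w).
  have mXY (j : 'I_m) : [set: 'I_m] j -> measurable_fun setT (fun w => (XX j w, YY j w)).
    by move=> _; apply: measurable_fun_pair; exact: measurable_funP.
  pose TV := g_sigma_algebraType (\bigcup_(j in [set: 'I_m])
    preimage_set_system setT (fun w => (XX j w, YY j w)) measurable).
  have mV j : measurable_fun setT (fun w : TV => (XX j w, YY j w)).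
    exact: (@measurable_process _ _ _ _ _ setT (fun j w => (XX j w, YY j w)) j I).
  pose phi (z : R * TV) := h (theta z.1, pairs_mx (fun j => XX j z.2) (fun j => YY j z.2)).
  have mphi : measurable_fun setT phi.
    have mx j : measurable_fun setT (fun z : R * TV => XX j z.2).
      exact: (measurableT_comp (measurableT_comp measurable_fst (mV j)) measurable_snd).
    have my j : measurable_fun setT (fun z : R * TV => YY j z.2).
      exact: (measurableT_comp (measurableT_comp measurable_snd (mV j)) measurable_snd).
    exact: (jm _ (R * TV)%type fst (fun j z => XX j z.2) (fun j z => YY j z.2) f
      measurable_fst mx my cf).
  have [mI eI] := @independent_Fubini _ _ _ P' _ _ _ _ _ _ setT (fun=> Z : T' -> R) setT
    (fun j w => (XX j w, YY j w)) mXY tt I mZ Z_indep phi M mphi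
    (fun z => hM _).
  by split; [exact: mI|exact: eI].
rewrite gE.
(* Independence is assumed for nonnegative times only; t > 0 is enough for a limit at +oo. *)
have uE t : 0 < t -> \int[P]_w f (U t (N t w) w) = \int[P]_w u t (N t w).
  move=> t0.
  have mXY (n : nat) : [set: nat] n -> measurable_fun setT (fun w => (X n w, Y n w)).
    by move=> _; apply: measurable_fun_pair; exact: measurable_funP.
  pose TV := g_sigma_algebraType (\bigcup_(n in [set: nat])
    preimage_set_system setT (fun w => (X n w, Y n w)) measurable).
  have mV n : measurable_fun setT (fun w : TV => (X n w, Y n w)).
    exact: (@measurable_process _ _ _ _ _ setT (fun n w => (X n w, Y n w)) n I).
  pose phi (z : nat * TV) := f (U t z.1 z.2).
  have mphi : measurable_fun setT phi.
    have mx n : measurable_fun setT (fun z : nat * TV => X n z.2).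
      exact: (measurableT_comp (measurableT_comp measurable_fst (mV n)) measurable_snd).
    have my n : measurable_fun setT (fun z : nat * TV => Y n z.2).
      exact: (measurableT_comp (measurableT_comp measurable_snd (mV n)) measurable_snd).
    exact: (@measurable_upper_order_stats R m _ (nat * TV)%type (fun n z => X n z.2)
      (fun n z => Y n z.2) fst (a1 t) (b1 t) (a2 t) (b2 t) f mx my measurable_fst cf).
  have [_ eI] := @independent_Fubini _ _ _ P _ _ _ _ _ _ [set t | 0 <= t]
    (fun t => N t : T -> nat) setT (fun n w => (X n w, Y n w)) mXY t (ltW t0)
    (mN t) N_indep phi M mphi (fun z => fM _).
  exact: eI.
have cg (s : R) : 0 < s -> {for s, continuous g}.
  move=> s0; have cG := @continuous_Rintegral_param _ _ _ P' _ ((R * R) * (R * R))%type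
    L (@mx_l1 m 2 R) h M mL (@mx_l1_continuous m 2 R) (@mx_l1_compact m 2 R) ch hM.
  exact: (continuous_comp (theta_cvg s s0) (cG (theta s))).
suff ucvg : \int[P]_w u t (N t w) @[t --> +oo] --> \int[P']_w g (Z w).
  apply: cvg_trans ucvg; apply: near_eq_cvg; near=> t.
  rewrite -uE//; near: t; apply: nbhs_pinfty_gt; exact: num_real.
apply: (@cvg_random_index _ _ _ _ _ P P' (fun t => N t) Z _ _ Z_pos Z_cvg u g M) => //.
- by move=> t n; apply: le_Rintegral_cst => [|w]; [exact: mU|exact: fM].
- move=> s; apply: le_Rintegral_cst => [|w]; last exact: hM.
  exact: mL _ (@continuous_pair_section _ _ _ h (theta s) ch).
move=> s e s0 e0.
have hcvg : \int[P]_w h (p.1, U p.2%:R p.2 w) @[p --> filter_prod (nbhs (theta s)) \oo]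
    --> g s.
  exact: (@cvg_in_distribution_param _ _ _ _ _ P P' _ nat \oo _ (fun n => U n%:R n) L
    (fun n => mU n%:R n) mL _ (@mx_l1_continuous m 2 R) (@mx_l1_compact m 2 R)
    _ h M (theta s) stat_cvg ch hM).
(* Sends (s', t) to the rescaling coefficients together with a sample size; when t s' is an integer
   n, truncation returns n itself. *)
pose q (p : R * R) := (((a1 (p.2 * p.1) / a1 p.2, (b1 (p.2 * p.1) - b1 p.2) / a1 p.2),
  (a2 (p.2 * p.1) / a2 p.2, (b2 (p.2 * p.1) - b2 p.2) / a2 p.2)), Num.truncn (p.2 * p.1)).
have p1cvg : p.1 @[p --> filter_prod (nbhs s) (pinfty_nbhs R)] --> s by exact: cvg_fst.
have large A : \forall p \near filter_prod (nbhs s) (pinfty_nbhs R), A <= p.2 * p.1.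
  by have /cvgryPge := cvg_snd_mul_fst s0; exact.
have qcvg : q p @[p --> filter_prod (nbhs s) (pinfty_nbhs R)] -->
    filter_prod (nbhs (theta s)) \oo.
  have [c1 e1] := types1 s s0; have [c2 e2] := types2 s s0.
  apply: (@cvg_pair _ _ _ _ (nbhs (theta s)) \oo).
    by apply: cvg_pair_nbhs; exact: cvg_pair_nbhs.
  move=> B [n _ nB]; apply: filterS (large n%:R) => p np; apply: nB => /=.
  by rewrite truncn_ge_nat// (le_trans _ np).
have e20 : 0 < e / 2 by rewrite divr_gt0.
have hq : \forall p \near filter_prod (nbhs s) (pinfty_nbhs R),
    `|g s - \int[P]_w h ((q p).1, U (q p).2%:R (q p).2 w)| <= e / 2.
  by have /cvgrPdist_le := cvg_comp _ _ qcvg hcvg; exact.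
have hg : \forall p \near filter_prod (nbhs s) (pinfty_nbhs R), `|g s - g p.1| <= e / 2.
  by have /cvgrPdist_le := cvg_comp _ _ p1cvg (cg s s0); exact.
have ht : \forall p \near filter_prod (nbhs s) (pinfty_nbhs R), 0 < p.2.
  have p2cvg : p.2 @[p --> filter_prod (nbhs s) (pinfty_nbhs R)] --> +oo by exact: cvg_snd.
  by move/cvgryPgt : p2cvg; exact.
(* The condition t s' >= 1 gives n > 0, hence a_i(n) > 0, so the statistics normalised at t are an
   affine image of those normalised at n. *)
apply: filterS (filterI (filterI hq hg) (filterI ht (large 1))) => -[s' t] /=.
move=> [[hqp hgp] [t0 ts1]] n nE.
have n0 : (0 : R) < n%:R by rewrite nE (lt_le_trans ltr01).
have uq : u t n = \int[P]_w h ((q (s', t)).1, U (q (s', t)).2%:R (q (s', t)).2 w).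
  rewrite /q /= -nE natrK; apply: eq_Rintegral => w _; congr f.
  by apply: upper_order_stats_affine; rewrite lt0r_neq0// ?a1_pos ?a2_pos.
rewrite -{}uq in hqp; move: hqp hgp; rewrite !ler_norml => /andP[? ?] /andP[? ?].
by apply/andP; split; lra.
Unshelve. all: by end_near. Qed.
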